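(* Let $a,b\geq 2$ be integers. Let $0<t<\min\{\log b,(\log a)^2/\log b\}$ and let $K_t$ be the set of $x\in\mathbb{T}$ such that $\delta_{\times a,\times b,x}^N$ $(N\in\mathbb{N})$ accumulates to some $\mu\in M_{\times a,\times b}(\mathbb{T})$ such that $h_\mu(T_a)\leq t$. Then $$\dim_H K_t\leq\frac{2\sqrt{\log b}\,\sqrt{t}}{\log a+\sqrt{\log b}\,\sqrt{t}},$$ where $\dim_H$ denotes Hausdorff dimension.
   Context: $\mathbb{N}$ is the set of positive integers and $\mathbb{T}=\mathbb{R}/\mathbb{Z}$ with its standard metric. For an integer $c\ge 2$, $T_c:\mathbb{T}\to\mathbb{T}$ is $T_c(x)=cx$. $M(\mathbb{T})$ is the set of Borel probability measures on $\mathbb{T}$ with the weak* topology, and $M_{\times a,\times b}(\mathbb{T})$ is the set of $\mu\in M(\mathbb{T})$ invariant under both $T_a$ and $T_b$. $h_\mu(T_a)$ is the measure-theoretic entropy of $T_a$ with respect to $\mu$ (natural logarithms). For $x\in\mathbb{T}$ and $N\in\mathbb{N}$, the $N$-empirical measure of $x$ is $$\delta_{\times a,\times b,x}^N=\frac{1}{N^2}\sum_{m,n=0}^{N-1}\delta_{T_a^mT_b^nx}\in M(\mathbb{T}),$$ where $\delta_y$ is the probability measure supported on $\{y\}$. The sequence $\delta_{\times a,\times b,x}^N$ $(N\in\mathbb{N})$ accumulates to $\mu$ if $\delta_{\times a,\times b,x}^{N_k}\to\mu$ in $M(\mathbb{T})$ as $k\to\infty$ for some divergent subsequence $\{N_k\}_{k=1}^\infty$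 in $\mathbb{N}$. *)

(* Defs.v *)
From HB Require Import structures.
From mathcomp Require Import all_boot all_order all_algebra.
From mathcomp Require Import generic_quotient ring_quotient archimedean.
From mathcomp Require Import all_classical all_reals all_analysis.

Set Implicit Arguments.
Unset Strict Implicit.
Unset Printing Implicit Defensive.

Import Order.TTheory GRing.Theory Num.Theory.
Import numFieldNormedType.Exports.

Local Open Scope classical_set_scope.
Local Open Scope ring_scope.
Local Open Scope quotient_scope.

Section HausdorffDimension.
Context {R : realType} {X : metricType R}.
Implicit Types (A U : set X) (s d : R).
Local Open Scope ereal_scope.

(* [maxe 0] only serves to give the empty set diameter 0. *)
Definition diam U : \bar R :=
  maxe 0 (ereal_sup [set (mdist p.1 p.2)%:E | p in U `*` U]).

(* With 0 `^ 0 = 1, the test on [set0] makes the 0-dimensional Hausdorff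
   measure the counting measure. *)
Definition hausdorff_gauge s U : \bar R :=
  if U == set0 then 0 else diam U `^ s.

Definition hausdorff_pre s d A : \bar R :=
  ereal_inf [set \sum_(0 <= i <oo) hausdorff_gauge s (U i) |
    U in [set U : (set X)^nat |
      A `<=` \bigcup_i U i /\ forall i, diam (U i) <= d%:E]].

Definition hausdorff_measure s A : \bar R :=
  ereal_sup [set hausdorff_pre s d A | d in [set d | (0 < d)%R]].

Definition hausdorff_dim A : \bar R :=
  ereal_inf [set s%:E | s in [set s | (0 <= s)%R /\ hausdorff_measure s A = 0]].

End HausdorffDimension.

Section Entropy.
Context d (X : measurableType d) (R : realType).
Variables (mu : probability X R) (T : X -> X).

Definition measure_preserving :=
  forall A, measurable A -> mu (T @^-1` A) = mu A.

(* A finite measurable partition is given by its labelling by a finite type;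
   its cells are the fibres of the labelling. *)
Definition measurable_partition (I : finType) (xi : X -> I) :=
  forall i, measurable (xi @^-1` [set i]).

Definition partition_entropy (I : finType) (xi : X -> I) : R :=
  - \sum_(i : I)
      fine (mu (xi @^-1` [set i])) * ln (fine (mu (xi @^-1` [set i]))).

(* the join of the partitions T^-i xi for i < n *)
Definition iterated_join (I : finType) (xi : X -> I) (n : nat) :
  X -> {ffun 'I_n -> I} := fun x => [ffun i : 'I_n => xi (iter i T x)].

Definition entropy_of_partition (I : finType) (xi : X -> I) : R :=
  limn (fun n : nat => n%:R^-1 * partition_entropy (iterated_join xi n)).

Definition entropy : \bar R :=
  ereal_sup [set h | exists k (xi : X -> 'I_k),
    measurable_partition xi /\ h = (entropy_of_partition xi)%:E].

End Entropy.

Section Circle.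
Context {R : realType}.

Definition circle : Type :=
  Quotient.quot (GRing.ZmodClosed.clone R Num.int_num_subdef _).

HB.instance Definition _ := GRing.Zmodule.on circle.
HB.instance Definition _ := ZmodQuotient.on circle.
HB.instance Definition _ := isPointed.Build circle 0.

Implicit Types x y z : circle.

(* distance from x to 0 on the circle *)
Definition circle_norm x : R :=
  inf [set `|r| | r in [set r : R | \pi_circle r = x]].

Definition circle_dist x y : R := circle_norm (x - y).

Lemma circle_norm_has_inf x :
  has_inf [set `|r| | r in [set r : R | \pi_circle r = x]].
Proof.
split; first by exists `|repr x|; exists (repr x) => //=; rewrite reprK.
by exists 0 => _ [r _ <-].
Qed.

Lemma circle_norm_ltP x e : circle_norm x < e ->
  exists2 r : R, \pi_circle r = x & `|r| < e.
Proof.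
move=> /inf_lt[|_ [r rx <-] re]; last by exists r.
by case: (circle_norm_has_inf x).
Qed.

Lemma circle_norm_le x (r : R) : \pi_circle r = x -> circle_norm x <= `|r|.
Proof.
move=> rx; apply: ge_inf; last by exists r.
by case: (circle_norm_has_inf x).
Qed.

Lemma circle_norm_ge0 x : 0 <= circle_norm x.
Proof.
by apply: lb_le_inf => [|_ [r _ <-]//]; case: (circle_norm_has_inf x).
Qed.

Lemma circle_distxx x : circle_dist x x = 0.
Proof.
apply/eqP; rewrite eq_le circle_norm_ge0 andbT /circle_dist subrr.
by rewrite -(normr0 R) circle_norm_le// raddf0.
Qed.

Lemma circle_dist_sym x y : circle_dist x y = circle_dist y x.
Proof.
have H z : circle_norm z <= circle_norm (- z).
  apply: lb_le_inf => [|_ [r rz <-]]; first by case: (circle_norm_has_inf (- z)).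
  by rewrite -normrN circle_norm_le// raddfN /= rz opprK.
apply/eqP; rewrite eq_le /circle_dist -(opprB y x) H andbT.
by rewrite -{2}(opprK (y - x)) H.
Qed.

Lemma circle_dist_triangle y x z :
  circle_dist x z <= circle_dist x y + circle_dist y z.
Proof.
apply/ler_addgt0Pr => e e0.
have e20 : 0 < e / 2 by rewrite divr_gt0.
have [|r rxy re] := @circle_norm_ltP (x - y) (circle_dist x y + e / 2).
  by rewrite ltrDl.
have [|q qyz qe] := @circle_norm_ltP (y - z) (circle_dist y z + e / 2).
  by rewrite ltrDl.
have : circle_dist x z <= `|r + q|.
  by apply: circle_norm_le; rewrite raddfD /= rxy qyz addrA subrK.
move=> /le_trans; apply; apply: (le_trans (ler_normD _ _)).
by rewrite [e in leRHS]splitr addrACA lerD// ltW.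
Qed.

Lemma circle_dist_positivity x y : circle_dist x y = 0 -> x = y.
Proof.
move=> xy0; apply/eqP; rewrite -subr_eq0; apply/eqP.
have [|r rxy r2] := @circle_norm_ltP (x - y) 2^-1.
  by rewrite -/(circle_dist x y) xy0 invr_gt0.
have [r0|r0] := eqVneq r 0; first by rewrite -rxy r0 raddf0.
have [|q qxy qr] := @circle_norm_ltP (x - y) `|r|.
  by rewrite -/(circle_dist x y) xy0 normr_gt0.
have /eqP : \pi_circle r = \pi_circle q by rewrite rxy qxy.
rewrite -[_ == _]/(_ == _ %[mod circle]).
rewrite -Quotient.idealrBE => rqint.
have [rq|rq] := eqVneq (r - q) 0.
  by move: qr; rewrite -(subr0_eq rq) ltxx.
have := norm_intr_ge1 rqint rq.
rewrite leNgt => /negP; case; apply: (le_lt_trans (ler_normB _ _)).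
by rewrite [ltRHS]splitr mul1r ltrD// (lt_trans qr).
Qed.

HB.instance Definition _ := @isMetric.Build R circle circle_dist
  circle_distxx circle_dist_positivity circle_dist_sym circle_dist_triangle.

HB.instance Definition _ :=
  Measurable.copy circle (g_sigma_algebraType (@open circle)).

Definition times_map (c : nat) : circle -> circle := fun x => x *+ c.

Definition integrals (mu : probability circle R) :
    {ptws continuousType circle R -> R} :=
  fun f => (\int[mu]_x f x)%R.

(* The Borel probability measures on the circle with the weak* topology: the
   coarsest one making mu |-> \int f dmu continuous for every continuous f. *)
Definition borel_prob : Type := initial_topology integrals.

HB.instance Definition _ := Topological.on borel_prob.

Definition invariant_prob (a b : nat) : set (probability circle R) :=
  [set mu | measure_preserving mu (times_map a)
    /\ measure_preserving mu (times_map b)].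

Definition orbit_point (a b m n : nat) x : circle :=
  iter m (times_map a) (iter n (times_map b) x).

Definition empirical (a b : nat) x (N : nat) : set circle -> \bar R :=
  mscale (N%:R ^- 2)%:nng
    (msum (fun m => msum (fun n => \d_(orbit_point a b m n x)) N) N).

HB.instance Definition _ a b x N := Measure.on (empirical a b x N).

Lemma empirical_setT a b x N : empirical a b x N.+1 setT = 1%E.
Proof.
rewrite /empirical /mscale /= /msum /=.
have sumN (r : R) : (\sum_(k < N.+1) r%:E = (N.+1%:R * r)%:E)%E.
  by rewrite sumEFin sumr_const card_ord mulr_natl.
rewrite (eq_bigr (fun=> (N.+1%:R%:E)%E)) => [|k _]; last first.
  by rewrite /msum (eq_bigr (fun=> 1%E)) ?sumN ?mulr1// => n _; exact: diracT.
by rewrite sumN -EFinM -expr2 mulVf// expf_neq0// pnatr_eq0.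
Qed.

(* Empirical measures are probability measures for N >= 1 only. *)
HB.instance Definition _ a b x N :=
  Measure_isProbability.Build _ _ _ (empirical a b x N.+1)
    (empirical_setT a b x N).

Definition empirical_prob (a b : nat) x (N : nat) : probability circle R :=
  empirical a b x N.+1.

(* Since [empirical_prob a b x N] is the (N+1)-empirical measure, the
   subsequence of positive integers is k |-> (N_ k).+1. *)
Definition accumulation_measure (a b : nat) x (mu : probability circle R) :=
  exists N_ : nat -> nat, N_ @ \oo --> \oo /\
    (fun k => empirical_prob a b x (N_ k) : borel_prob) @ \oo -->
      (mu : borel_prob).

Definition small_entropy_set (a b : nat) (t : R) : set circle :=
  [set x | exists mu : probability circle R,
    [/\ invariant_prob a b mu, accumulation_measure a b x mu
      & (entropy mu (times_map a) <= t%:E)%E]].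

End Circle.

Arguments circle : clear implicits.
Arguments borel_prob : clear implicits.

(* Main.v *)
From HB Require Import structures.
Require Import Defs.
From mathcomp Require Import all_boot all_order all_algebra.
From mathcomp Require Import generic_quotient ring_quotient archimedean.
From mathcomp Require Import all_classical all_reals all_analysis.
From mathcomp Require Import measurable_realfun ring lra zify.
Import Order.TTheory GRing.Theory Num.Theory.
Import numFieldNormedType.Exports.
Local Open Scope ring_scope.
Local Open Scope classical_set_scope.
Local Open Scope quotient_scope.

(** Small entropy means few words, and few words mean few arcs.

    Let the empirical measures of [x] accumulate to an invariant measure [mu]
    whose entropy for multiplication by [a] is at most [t]. For a long block
    length [k], the partition of the circle into arcs of length [1 / a ^ k] has
    entropy at most about [k t] ([small_entropy_digit]); that is, the
    information [- ln (mu w)] of the cell [w] of a point has integral about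
    [k t] for [mu]. By weak* convergence, its average over the points
    [a ^ m b ^ l x] with [m, l < N] is at most about [k t] for infinitely many
    [N] ([small_entropy_low_cost]).

    Fix [th] between 0 and 1. Information being nonnegative, some row
    [l <= th N] has average at most [k t / th] ([pigeonhole_row]). Reading this
    row in blocks of length [k] gives a word of about [N] digits in base [a],
    the beginning of the expansion of [b ^ l x], whose mass for a product
    measure is at least [exp (- N t / th)]; there are thus at most
    [exp (N t / th)] such words ([card_heavy]). As [b ^ l x] has [b ^ l]
    preimages, [x] lies in one of [b ^ l exp (N t / th)] arcs of length
    [1 / (a ^ N b ^ l)], up to factors that do not depend on [N]. For [s <= 1]
    and each such row, the sum of the [s]-th powers of these lengths is thus at
    most a constant times the exponential of
    [N ((1 - s) th ln b + t / th - s ln a)], and a Borel--Cantelli argument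
    shows that the [s]-dimensional measure vanishes once the bracket is
    negative ([hausdorff_null_low_cost]). For [th = sqrt (t / ln b)], which is
    less than 1 because [t < ln b], both [th ln b] and [t / th] are equal to
    [beta = sqrt (ln b) sqrt t], and the condition reads
    [s > 2 beta / (ln a + beta)]; the hypothesis [t < (ln a) ^ 2 / ln b] says
    that [beta < ln a], so that such an [s] exists below 1.

    Two points need care. The information of a cell is not a continuous
    function and [mu] may charge endpoints of cells; it is replaced by a
    continuous [cost], built from tents in place of indicator functions, which
    changes it by a bounded amount that becomes negligible as [k] grows. And
    the exceptional sets must form a countable family, although there are
    uncountably many measures [mu]; the masses of the cells are therefore
    rounded to finitely many values ([quantize]), again at a bounded cost. *)

Set Implicit Arguments.
Unset Strict Implicit.
Unset Printing Implicit Defensive.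

(** * Hausdorff null sets *)

Section HausdorffNull.
Context {R : realType} {X : metricType R}.
Implicit Types (A U : set X) (s d : R).
Local Open Scope ereal_scope.

Lemma diam0 : diam (set0 : set X) = 0.
Proof. by rewrite /diam setX0 image_set0 ereal_sup0 maxeNy. Qed.

Lemma diam_ge0 U : 0 <= diam U.
Proof. by rewrite /diam le_max lexx. Qed.

Lemma hausdorff_gauge0 s : hausdorff_gauge s (set0 : set X) = 0.
Proof. by rewrite /hausdorff_gauge eqxx. Qed.

Lemma hausdorff_gauge_ge0 s U : 0 <= hausdorff_gauge s U.
Proof. by rewrite /hausdorff_gauge; case: ifP => // _; exact: poweR_ge0. Qed.

Lemma hausdorff_pre_ge0 s d A : 0 <= hausdorff_pre s d A.
Proof.
apply: le_ereal_inf_tmp => _ [U [_ _] <-].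
by apply: nneseries_ge0 => *; exact: hausdorff_gauge_ge0.
Qed.

Lemma hausdorff_pre_le s d A B : A `<=` B ->
  hausdorff_pre s d A <= hausdorff_pre s d B.
Proof.
move=> AB; apply: ereal_inf_le_tmp => _ [U [BU dU] <-].
by exists U => //; split => //; exact: subset_trans BU.
Qed.

(** Measurable spaces are pointed, hence the choice of a base point. *)
Definition at_point (x0 : X) : Type := X.

HB.instance Definition _ x0 := Choice.copy (at_point x0) X.
HB.instance Definition _ x0 := isPointed.Build (at_point x0) x0.

Let discrete x0 := g_sigma_algebraType [set: set (at_point x0)].

Definition gauge_upto s d U : \bar R :=
  if diam U <= d%:E then hausdorff_gauge s U else +oo.

Lemma gauge_upto_ge0 s d U : 0 <= gauge_upto s d U.
Proof.
by rewrite /gauge_upto; case: ifP => // _; exact: hausdorff_gauge_ge0.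
Qed.

(** Giving oversized sets infinite mass absorbs the size restriction on covers,
    and exhibits the premeasure as the outer measure generated by a set function
    on the structure in which every set is measurable; countable subadditivity
    is inherited from there. *)
Lemma hausdorff_preE x0 s d :
  hausdorff_pre s d = mu_ext (gauge_upto s d : set (discrete x0) -> \bar R).
Proof.
apply/funext => A; apply/eqP; rewrite eq_le; apply/andP; split; last first.
  apply: ereal_inf_le_tmp => _ [U [AU dU] <-].
  exists U; first by split => // i; exact: sub_gen_smallest.
  by apply: eq_eseriesr => i _; rewrite /gauge_upto dU.
apply: le_ereal_inf_tmp => _ [U [_ AU] <-].
have [dU|] := pselect (forall i, diam (U i : set X) <= d%:E).
  apply: ereal_inf_lbound; exists U => //.
  by apply: eq_eseriesr => i _; rewrite /gauge_upto dU.
rewrite -existsNE => -[i /negP dU].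
rewrite (@eseries_pinfty _ _ _ i) ?leey// ?/gauge_upto ?(negbTE dU)// => n _.
by rewrite -ltNye (lt_le_trans _ (gauge_upto_ge0 s d _)).
Qed.

Lemma hausdorff_pre_bigcup s d (A : (set X)^nat) : (0 <= d)%R ->
  hausdorff_pre s d (\bigcup_n A n) <= \sum_(n <oo) hausdorff_pre s d (A n).
Proof.
move=> d0; have [[x0 _]|noX] := pselect (exists x : X, True).
  rewrite (hausdorff_preE x0).
  have mu0 : forall B : set (discrete x0), 0 <= gauge_upto s d B.
    by move=> B; exact: gauge_upto_ge0.
  exact: (mu_ext_sigma_subadditive mu0 A).
apply: (@le_trans _ _ 0).
  apply: ereal_inf_lbound; exists (fun=> set0).
    split=> [x|_]; first by case: noX; exists x.
    by rewrite diam0 lee_fin.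
  rewrite eseries0// => n _ _; exact: hausdorff_gauge0.
by apply: nneseries_ge0 => *; exact: hausdorff_pre_ge0.
Qed.

Lemma hausdorff_pre_fin s d (I : finType) (P : pred I) (U : I -> set X) A :
  (forall i, P i -> diam (U i) <= d%:E) -> (0 <= d)%R ->
  A `<=` [set x | exists2 i, P i & U i x] ->
  hausdorff_pre s d A <= \sum_(i | P i) hausdorff_gauge s (U i).
Proof.
move=> dU d0 AU; pose e := [seq i <- index_enum I | P i].
pose V n := nth set0 (map U e) n.
have VE n : (size e <= n)%N -> V n = set0.
  by move=> en; rewrite /V nth_default ?size_map.
apply: ereal_inf_lbound; exists V.
  split=> [x /AU[i Pi Uix]|n].
    have ie : i \in e by rewrite mem_filter Pi mem_index_enum.
    exists (index i e) => //=.
    by rewrite /V (nth_map i) ?index_mem// nth_index.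
  have [en|ne] := leqP (size e) n; first by rewrite VE// diam0 lee_fin.
  have : V n \in map U e by apply: mem_nth; rewrite size_map.
  by move=> /mapP[i]; rewrite mem_filter => /andP[Pi _] ->; exact: dU.
rewrite (nneseries_split 0 (size e)) ?add0n//; last first.
  by move=> *; exact: hausdorff_gauge_ge0.
rewrite [X in _ + X]eseries0 ?adde0; last first.
  by move=> n en _; rewrite VE ?hausdorff_gauge0.
rewrite -[RHS]big_filter -/e.
rewrite -(big_map U xpredT (hausdorff_gauge s)) (big_nth set0) size_map.
by [].
Qed.

Lemma hausdorff_measure_eq0 s A : hausdorff_measure s A = 0 <->
  forall d, (0 < d)%R -> hausdorff_pre s d A = 0.
Proof.
split=> [A0 d d0|A0].
  apply/eqP; rewrite eq_le hausdorff_pre_ge0 andbT -A0.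
  by apply: ereal_sup_ubound; exists d.
apply/eqP; rewrite eq_le; apply/andP; split.
  by apply: ge_ereal_sup => _ [d d0 <-]; rewrite A0.
apply: (le_trans (hausdorff_pre_ge0 s 1%R A)).
by apply: ereal_sup_ubound; exists 1%R => //=.
Qed.

Lemma hausdorff_null_sub s A B : A `<=` B ->
  hausdorff_measure s B = 0 -> hausdorff_measure s A = 0.
Proof.
move=> AB /hausdorff_measure_eq0 B0.
apply/hausdorff_measure_eq0 => d d0; apply/eqP.
by rewrite eq_le hausdorff_pre_ge0 andbT -(B0 d d0) hausdorff_pre_le.
Qed.

Lemma hausdorff_null0 s : hausdorff_measure s (set0 : set X) = 0.
Proof.
apply/hausdorff_measure_eq0 => d d0; apply/eqP.
rewrite eq_le hausdorff_pre_ge0 andbT.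
have := @hausdorff_pre_fin s d void pred0 (fun=> set0) set0.
by rewrite big_pred0//; apply => //; exact: ltW.
Qed.

Lemma hausdorff_null_bigcup (I : countType) s (A : I -> set X) :
  (forall i, hausdorff_measure s (A i) = 0) ->
  hausdorff_measure s (\bigcup_i A i) = 0.
Proof.
move=> A0; pose B n := if unpickle n is Some i then A i else set0.
have B0 n : hausdorff_measure s (B n) = 0.
  by rewrite /B; case: unpickle => // *; exact: hausdorff_null0.
apply: (@hausdorff_null_sub _ _ (\bigcup_n B n)).
  by move=> x [i _ Aix]; exists (pickle i); rewrite /B ?pickleK.
apply/hausdorff_measure_eq0 => d d0; apply/eqP.
rewrite eq_le hausdorff_pre_ge0 andbT.
apply: (le_trans (hausdorff_pre_bigcup s B (ltW d0))).
by rewrite eseries0// => n _ _; apply: (hausdorff_measure_eq0 s (B n)).1.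
Qed.

(** Borel--Cantelli: the limit superior is covered by every tail of [E], and
    the tails of a convergent geometric series tend to 0. *)
Lemma hausdorff_null_limsup s (E : (set X)^nat) (C rho : R) :
  (0 <= C)%R -> (0 < rho < 1)%R ->
  (forall d, (0 < d)%R -> \forall n \near \oo,
    hausdorff_pre s d (E n) <= (C * rho ^+ n)%:E) ->
  hausdorff_measure s [set x | forall n, exists2 m, (n <= m)%N & E m x] = 0.
Proof.
move=> C0 /andP[r0 r1] HE; apply/hausdorff_measure_eq0 => d d0.
have [N _ HN] := HE d d0.
set K := [set x | _].
have bound n : (N <= n)%N ->
    hausdorff_pre s d K <= (C * rho ^+ n / (1 - rho))%:E.
  move=> Nn; apply: (@le_trans _ _ (hausdorff_pre s d (\bigcup_i E (n + i)%N))).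
    apply: hausdorff_pre_le => x /(_ n)[m nm Emx].
    by exists (m - n)%N => //; rewrite subnKC.
  apply: (le_trans (hausdorff_pre_bigcup _ _ (ltW d0))).
  apply: (@le_trans _ _ (\sum_(i <oo) (geometric (C * rho ^+ n) rho i)%:E)).
    apply: lee_nneseries => i *; first exact: hausdorff_pre_ge0.
    rewrite /geometric/= -mulrA -exprD; apply: HN => /=.
    by rewrite (leq_trans Nn)// leq_addr.
  have := @cvg_geometric_series R (C * rho ^+ n) rho.
  rewrite ger0_norm ?(ltW r0)// => /(_ r1) cg.
  rewrite le_eqVlt; apply/orP; left; apply/eqP.
  apply/cvg_lim => //.
  under eq_fun do rewrite sumEFin.
  by apply: cvg_EFin; [exact: nearW|exact: cg].
apply/eqP; rewrite eq_le hausdorff_pre_ge0 andbT.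
have cv : (C * rho ^+ n / (1 - rho))%:E @[n --> \oo] --> 0.
  apply: cvg_EFin; first exact: nearW.
  have cr : (rho ^+ n)%R @[n --> \oo] --> (0 : R)%R.
    by apply: cvg_expr; rewrite ger0_norm ?(ltW r0).
  have -> : fine \o (fun n => (C * rho ^+ n / (1 - rho))%:E) =
      (fun n => (C / (1 - rho) * rho ^+ n)%R).
    by apply/funext => n /=; rewrite mulrAC.
  rewrite -[0%R](mulr0 (C / (1 - rho))%R).
  exact: cvgMl_tmp.
by apply: (cvge_ge _ cv); exists N => // n Nn; exact: bound.
Qed.
End HausdorffNull.

(** * Coordinates on the circle *)

Section CircleCoordinates.
Context {R : realType}.
Implicit Types (x y : circle R) (r q : R).

Lemma pi_circle_eq r q : \pi_(circle R) r = \pi_(circle R) q <->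
  exists e : int, r = q + e%:~R.
Proof.
have -> : (\pi_(circle R) r = \pi_(circle R) q) <-> (r - q \is a Num.int).
  rewrite (rwP eqP) -[_ == _]/(_ == _ %[mod circle R]) -Quotient.idealrBE.
  by [].
split=> [/intrP[e re]|[e ->]]; first by exists e; rewrite -re addrC subrK.
by rewrite addrC addKr intr_int.
Qed.

Lemma pi_circle_mulrn r c : \pi_(circle R) (r *+ c) = \pi_(circle R) r *+ c.
Proof. exact: raddfMn. Qed.

Definition frac x : R := repr x - (Num.floor (repr x))%:~R.

Lemma frac_ge0 x : 0 <= frac x.
Proof. by rewrite subr_ge0 floor_le. Qed.

Lemma frac_lt1 x : frac x < 1.
Proof. by rewrite ltrBlDr addrC -intrD1 floorD1_gt. Qed.

Lemma fracK x : \pi_(circle R) (frac x) = x.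
Proof.
rewrite -[RHS]reprK; apply/pi_circle_eq.
by exists (- Num.floor (repr x)); rewrite rmorphN.
Qed.

Lemma frac_pi r : 0 <= r < 1 -> frac (\pi_(circle R) r) = r.
Proof.
move=> /andP[r0 r1]; have /pi_circle_eq[e re] := fracK (\pi_(circle R) r).
have := frac_ge0 (\pi_(circle R) r); have := frac_lt1 (\pi_(circle R) r).
rewrite re => h1 h0; have e1 : (-1)%:~R < e%:~R :> R.
  by rewrite rmorphN /=; lra.
have e2 : e%:~R < 1%:~R :> R by lra.
move: e1 e2; rewrite !ltr_int => e1 e2; have -> : e = 0 by lia.
by rewrite addr0.
Qed.

Lemma circle_dist_pi r q :
  circle_dist (\pi_(circle R) r) (\pi_(circle R) q) <= `|r - q|.
Proof. by apply: circle_norm_le; rewrite raddfB. Qed.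

Lemma circle_dist_lt r q e :
  circle_dist (\pi_(circle R) r) (\pi_(circle R) q) < e ->
  exists z : int, `|r - q - z%:~R| < e.
Proof.
move=> /circle_norm_ltP[u]; rewrite -raddfB => /pi_circle_eq[z ->] ue.
by exists (- z); rewrite rmorphN opprK.
Qed.

Lemma mdist_circleE x y : mdist x y = circle_dist x y. Proof. by []. Qed.

Lemma ball_circleE x (e : R) : ball x e = [set y | circle_dist x y < e].
Proof. by []. Qed.

Lemma circle_dist_mulrn x y c :
  circle_dist (x *+ c) (y *+ c) <= c%:R * circle_dist x y.
Proof.
apply/ler_addgt0Pr => e e0.
have e1 : 0 < e / c.+1%:R by rewrite divr_gt0.
have [|r rxy re] := @circle_norm_ltP R (x - y) (circle_dist x y + e / c.+1%:R).
  by rewrite ltrDl.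
apply: (@le_trans _ _ `|r *+ c|).
  by apply: circle_norm_le; rewrite pi_circle_mulrn rxy mulrnBl.
rewrite -[r *+ c]mulr_natl normrM normr_nat.
apply: (@le_trans _ _ (c%:R * (circle_dist x y + e / c.+1%:R))).
  by rewrite ler_wpM2l// ltW.
rewrite mulrDr lerD2l mulrCA ger_pMr// ler_pdivrMr// mul1r ler_nat.
exact: leqnSn.
Qed.

Lemma times_mapE c m x : iter m (times_map c) x = x *+ c ^ m.
Proof.
elim: m => [|m IH]; first by rewrite expn0 mulr1n.
by rewrite iterS IH /times_map -mulrnA expnSr.
Qed.

Lemma orbit_pointE a b m n x : orbit_point a b m n x = x *+ (a ^ m * b ^ n).
Proof. by rewrite /orbit_point !times_mapE -mulrnA mulnC. Qed.

Lemma continuous_times_map c : continuous (@times_map R c).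
Proof.
move=> x A /nbhs_ballP[e /= e0 eA]; apply/nbhs_ballP.
exists (e / c.+1%:R); first by rewrite /= divr_gt0.
move=> y xy; apply: eA; rewrite ball_circleE /=; move: xy.
rewrite ball_circleE /= => xy.
apply: (le_lt_trans (circle_dist_mulrn _ _ _)).
apply: (@le_lt_trans _ _ (c.+1%:R * circle_dist x y)).
  by rewrite ler_wpM2r ?circle_norm_ge0// ler_nat.
by rewrite mulrC -ltr_pdivlMr.
Qed.

Lemma continuous_circle_dist x : continuous (fun y => circle_dist y x).
Proof.
move=> y A /nbhs_ballP[e /= e0 eA]; apply/nbhs_ballP; exists e => //= z.
rewrite ball_circleE /= => yz; apply: eA; rewrite /ball /=.
have := circle_dist_triangle z y x; have := circle_dist_triangle y z x.
rewrite (circle_dist_sym z y) => h1 h2.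
by rewrite ltr_norml; apply/andP; split; lra.
Qed.

Lemma open_circle_measurable (A : set (circle R)) : open A -> measurable A.
Proof. by move=> oA; apply: sub_gen_smallest. Qed.

Lemma continuous_circle_measurable (f : circle R -> R) :
  continuous f -> measurable_fun setT f.
Proof.
move=> cf; apply: (measurability _ (RGenOpens.measurableE R)).
move=> _ [_ [a [b ->] <-]]; rewrite setTI; apply: open_circle_measurable.
by move/continuousP: cf; apply; exact: interval_open.
Qed.

Lemma measurable_times_map c : measurable_fun setT (@times_map R c).
Proof.
apply: (@measurability _ _ (circle R) (circle R) _ _ (@open (circle R))) => //.
move=> _ [A oA <-]; rewrite setTI; apply: open_circle_measurable.
by have /continuousP := @continuous_times_map c; apply.
Qed.

(** The arc has to avoid 0, where [frac] jumps; elsewhere [frac] is locally an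
    isometry. *)
Lemma frac_arc_open s : s <= 1 -> open [set x | 0 < frac x < s].
Proof.
move=> s1; rewrite openE => x /= /andP[x0 xs].
apply/nbhs_ballP; exists (Num.min (frac x) (s - frac x)).
  by rewrite /= lt_min x0 subr_gt0.
move=> y; rewrite ball_circleE /= => /circle_norm_ltP[r rxy].
rewrite lt_min => /andP[r1 r2].
have yE : y = \pi_(circle R) (frac x - r).
  by rewrite raddfB /= fracK rxy opprB addrC subrK.
move: r1 r2; rewrite !ltr_norml => /andP[r1 r2] /andP[r3 r4].
by rewrite yE frac_pi; apply/andP; split; lra.
Qed.

Lemma measurable_frac_lt s : measurable [set x | frac x < s].
Proof.
have [s0|s0] := leP s 0.
  rewrite (_ : [set _ | _] = set0)//; apply/seteqP; split=> x //=.
  by rewrite ltNge (le_trans s0 (frac_ge0 x)).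
have [s1|s1] := leP s 1; last first.
  rewrite (_ : [set _ | _] = setT)//; apply/seteqP; split=> x //= _.
  exact: lt_trans (frac_lt1 x) s1.
(* 0 belongs to the set without being interior to it; it is recovered as the
   complement of the open set of nonzero points *)
rewrite (_ : [set _ | _] =
  ~` [set x | 0 < frac x < 1] `|` [set x | 0 < frac x < s]).
  apply: measurableU; first apply: measurableC.
    by apply: open_circle_measurable; exact: frac_arc_open.
  by apply: open_circle_measurable; exact: frac_arc_open.
apply/seteqP; split=> x /=; rewrite frac_lt1 andbT.
  by move=> xs; rewrite xs andbT; have [|] := boolP (0 < frac x); [right|left].
move=> [/negP|/andP[]//]; rewrite -leNgt => h; exact: le_lt_trans s0.
Qed.

End CircleCoordinates.

(** * Entropy of partitions *)

Section PartitionEntropy.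
Context d (X : measurableType d) (R : realType) (mu : probability X R).
Implicit Types (I J : finType) (A : set X).

Definition prob A : R := fine (mu A).

Lemma prob_ge0 A : 0 <= prob A.
Proof. by rewrite fine_ge0. Qed.

Lemma prob_le1 A : measurable A -> prob A <= 1.
Proof.
by move=> mA; rewrite -lee_fin fineK ?probability_le1// fin_num_measure.
Qed.

Lemma prob_setT : prob setT = 1.
Proof. by rewrite /prob probability_setT. Qed.

Lemma prob_split I (xi : X -> I) A : measurable_partition xi -> measurable A ->
  prob A = \sum_(i : I) prob (A `&` xi @^-1` [set i]).
Proof.
move=> mxi mA; have mAi i : measurable (A `&` xi @^-1` [set i]).
  exact: measurableI.
have AE : A = \bigcup_(i in [set: I]) (A `&` xi @^-1` [set i]).
  by apply/seteqP; split=> [x Ax|x [i _ []]//]; exists (xi x).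
rewrite {1}AE /prob measure_fin_bigcup//; last 2 first.
- exact: finite_finset.
- by move=> i j _ _ [x [[_ <-] [_ <-]]].
have -> : [set: I] = [set` enum I].
  by apply/seteqP; split=> i //= _; rewrite mem_enum.
rewrite -fsbig_seq ?enum_uniq// -sum_fine ?big_enum//= => i _.
exact: fin_num_measure.
Qed.

(** Relabelling the cells changes nothing; labels outside the image only add
    null cells. *)
Lemma partition_entropy_inj I J (f : I -> J) (xi : X -> I) : injective f ->
  partition_entropy mu (f \o xi) = partition_entropy mu xi.
Proof.
move=> fI; rewrite /partition_entropy; congr (- _).
rewrite [RHS](partition_big f xpredT)//=; apply: eq_bigr => j _.
have [[i fij]|nj] := pselect (exists i, f i = j).
  rewrite (big_pred1 i) => [|k]; last by rewrite -fij /= (inj_eq fI).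
  suff -> : (f \o xi) @^-1` [set j] = xi @^-1` [set i] by [].
  by apply/seteqP; split=> x /=; rewrite -fij; [move=> /fI|move=> ->].
rewrite big_pred0 => [|i]; last by apply/eqP => ij; apply: nj; exists i.
rewrite (_ : _ @^-1` _ = set0) ?measure0 ?mul0r//.
by apply/seteqP; split=> x //= xj; apply: nj; exists (xi x).
Qed.

Lemma partition_entropy_ge0 I (xi : X -> I) :
  measurable_partition xi -> 0 <= partition_entropy mu xi.
Proof.
move=> mxi; rewrite /partition_entropy -sumrN; apply: sumr_ge0 => i _.
rewrite -mulrN mulr_ge0 ?prob_ge0// oppr_ge0 ln_le0//.
exact: prob_le1.
Qed.

(** [ln u <= u - 1] at [u = q * r / p], in a form that includes [p = 0]. *)
Lemma gibbs_pointwise (p q r : R) : 0 <= p -> p <= q -> p <= r ->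
  p * (ln q + ln r - ln p) <= q * r - p.
Proof.
rewrite le_eqVlt => /predU1P[<- q0 r0|p0 pq pr].
  by rewrite mul0r subr0 mulr_ge0.
have q0 := lt_le_trans p0 pq; have r0 := lt_le_trans p0 pr.
rewrite -lnM ?posrE// -ln_div ?posrE ?mulr_gt0//.
have u0 : 0 < q * r / p by rewrite divr_gt0// mulr_gt0.
have : ln (q * r / p) <= q * r / p - 1.
  have := expR_ge1Dx (ln (q * r / p)); rewrite lnK ?posrE//; lra.
move=> /(ler_wpM2l (ltW p0)) /le_trans; apply.
by rewrite mulrBr mulr1 mulrCA divff ?gt_eqF// mulr1.
Qed.

(** Gibbs' inequality for the joint law against the product of the marginals. *)
Lemma partition_entropy_pair I J (xi : X -> I) (eta : X -> J) :
  measurable_partition xi -> measurable_partition eta ->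
  partition_entropy mu (fun x => (xi x, eta x)) <=
  partition_entropy mu xi + partition_entropy mu eta.
Proof.
move=> mxi meta.
pose p i j := prob (xi @^-1` [set i] `&` eta @^-1` [set j]).
pose q i := prob (xi @^-1` [set i]); pose r j := prob (eta @^-1` [set j]).
have qE i : q i = \sum_j p i j by exact: prob_split.
have rE j : r j = \sum_i p i j.
  rewrite /r (prob_split mxi)//; apply: eq_bigr => i _.
  by rewrite setIC.
have sq : \sum_i q i = 1.
  rewrite -prob_setT (prob_split mxi measurableT); apply: eq_bigr => i _.
  by rewrite setTI.
have sr : \sum_j r j = 1.
  rewrite -prob_setT (prob_split meta measurableT); apply: eq_bigr => i _.
  by rewrite setTI.
have pq i j : p i j <= q i.
  by rewrite qE (bigD1 j)//= lerDl sumr_ge0// => *; exact: prob_ge0.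
have pr i j : p i j <= r j.
  by rewrite rE (bigD1 i)//= lerDl sumr_ge0// => *; exact: prob_ge0.
have -> : partition_entropy mu (fun x => (xi x, eta x)) =
    - \sum_i \sum_j p i j * ln (p i j).
  rewrite /partition_entropy pair_big /=; congr (- _).
  apply: eq_bigr => -[i j] _ /=.
  suff -> : (fun x => (xi x, eta x)) @^-1` [set (i, j)] =
    xi @^-1` [set i] `&` eta @^-1` [set j] by [].
  by apply/seteqP; split=> x /= [-> ->].
have -> : partition_entropy mu xi = - \sum_i \sum_j p i j * ln (q i).
  by congr (- _); apply: eq_bigr => i _; rewrite -mulr_suml -qE.
have -> : partition_entropy mu eta = - \sum_i \sum_j p i j * ln (r j).
  rewrite exchange_big/=; congr (- _).
  by apply: eq_bigr => i _; rewrite -mulr_suml -rE.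
have : \sum_i \sum_j p i j * (ln (q i) + ln (r j) - ln (p i j)) <=
    \sum_i \sum_j (q i * r j - p i j).
  apply: ler_sum => i _; apply: ler_sum => j _.
  by apply: gibbs_pointwise; rewrite ?prob_ge0.
have -> : \sum_i \sum_j (q i * r j - p i j) = 0.
  under eq_bigr => i _ do rewrite sumrB -mulr_sumr sr mulr1 -qE subrr.
  by rewrite big1.
under eq_bigr => i _ do (under eq_bigr => j _ do rewrite mulrBr mulrDr;
  rewrite sumrB big_split).
rewrite sumrB big_split /=; lra.
Qed.

Variable T : X -> X.
Hypotheses (mT : measurable_fun setT T) (muT : measure_preserving mu T).

Lemma measurable_preimage_iter n A :
  measurable A -> measurable (iter n T @^-1` A).
Proof.
elim: n A => [//|n IH] A mA.
rewrite (_ : _ @^-1` _ = iter n T @^-1` (T @^-1` A))//.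
by apply: IH; rewrite -[X in measurable X]setTI; exact: mT.
Qed.

Lemma partition_entropy_iter I (xi : X -> I) n : measurable_partition xi ->
  partition_entropy mu (xi \o iter n T) = partition_entropy mu xi.
Proof.
move=> mxi; congr (- _); apply: eq_bigr => i _.
suff -> : mu ((xi \o iter n T) @^-1` [set i]) = mu (xi @^-1` [set i]) by [].
rewrite comp_preimage; move: (mxi i); move: (_ @^-1` _) => A mA.
elim: n A mA => [//|n IH] A mA.
rewrite (_ : _ @^-1` _ = iter n T @^-1` (T @^-1` A))// IH ?muT//.
exact: (@measurable_preimage_iter 1).
Qed.

Lemma measurable_iterated_join I (xi : X -> I) n : measurable_partition xi ->
  measurable_partition (iterated_join T xi n).
Proof.
move=> mxi w; rewrite (_ : _ @^-1` _ =
  \bigcap_(i in [set: 'I_n]) (iter i T @^-1` (xi @^-1` [set w i]))).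
  apply: fin_bigcap_measurable => // i _.
  by apply: measurable_preimage_iter.
apply/seteqP; split=> [x /= <- i _|x /= xw]; first by rewrite /= ffunE.
by apply/ffunP => i; rewrite ffunE; exact: xw.
Qed.

(** The first [m + n] symbols of an orbit are its first [m] symbols and the
    first [n] symbols of its [m]-th point, of the same law by invariance. *)
Lemma partition_entropy_join_subadd I (xi : X -> I) m n :
  measurable_partition xi ->
  partition_entropy mu (iterated_join T xi (m + n)) <=
  partition_entropy mu (iterated_join T xi m) +
  partition_entropy mu (iterated_join T xi n).
Proof.
move=> mxi.
pose f (w : {ffun 'I_(m + n) -> I}) : {ffun 'I_m -> I} * {ffun 'I_n -> I} :=
  ([ffun i => w (lshift n i)], [ffun i => w (rshift m i)]).
have fI : injective f.
  move=> v w [/ffunP h1 /ffunP h2]; apply/ffunP => i.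
  by case: (split_ordP i) => j ->; [move: (h1 j)|move: (h2 j)]; rewrite !ffunE.
rewrite -(partition_entropy_inj _ fI).
rewrite -(partition_entropy_iter m (measurable_iterated_join (n := n) mxi)).
have -> : f \o iterated_join T xi (m + n) =
    (fun x => (iterated_join T xi m x, iterated_join T xi n (iter m T x))).
  apply/funext => x /=; congr pair; apply/ffunP => i; rewrite !ffunE//=.
  by rewrite addnC iterD.
apply: partition_entropy_pair; first exact: measurable_iterated_join.
move=> w; rewrite comp_preimage; apply: measurable_preimage_iter.
exact: measurable_iterated_join.
Qed.

End PartitionEntropy.

Section Fekete.
Context {R : realType}.
Variable u : nat -> R.
Hypotheses (u0 : forall n, 0 <= u n)
  (uD : forall m n, u (m + n)%N <= u m + u n).

(** Fekete's lemma: dividing [n] by [m] with remainder bounds [u n] by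
    [(n %/ m) * u m] up to a constant, so that every [u m / m] is asymptotically
    an upper bound; the limit is the infimum. *)
Lemma is_cvg_subadditive : cvgn (fun n => n%:R^-1 * u n).
Proof.
pose E := [set n%:R^-1 * u n | n in [set n | (0 < n)%N]].
have E0 : has_inf E.
  split; first by exists (1^-1 * u 1%N), 1%N.
  by exists 0 => _ [n _ <-]; rewrite mulr_ge0// invr_ge0.
apply/cvg_ex; exists (inf E); apply/cvgrPdist_lt => e e0.
have e20 : 0 < e / 2 by rewrite divr_gt0.
have [_ [m /= m0 <-] mE] := inf_adherent e20 E0.
pose M := \sum_(r < m) u r.
have uqr q r : u (q * m + r)%N <= q%:R * u m + u r.
  elim: q => [|q IH]; first by rewrite mul0n add0n mul0r add0r.
  rewrite mulSn -addnA -natr1 mulrDl mul1r.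
  by apply: le_trans (uD _ _) _; move: IH; lra.
have uM n : u n <= (n %/ m)%:R * u m + M.
  rewrite {1}(divn_eq n m); apply: (le_trans (uqr _ _)); rewrite lerD2l.
  by rewrite /M (bigD1 (Ordinal (ltn_pmod n m0)))//= lerDl sumr_ge0.
have M0 : 0 <= M by exact: sumr_ge0.
near=> n.
have n0 : (0 < n)%N by near: n; exact: nbhs_infty_gt.
have n0R : 0 < n%:R :> R by rewrite ltr0n.
have m0R : 0 < m%:R :> R by rewrite ltr0n.
have infn : inf E <= n%:R^-1 * u n by apply: ge_inf; [case: E0|exists n].
have Mn : M / n%:R < e / 2.
  rewrite ltr_pdivrMr// mulrC -ltr_pdivrMr//.
  by near: n; exact: nbhs_infty_gtr.
have un : n%:R^-1 * u n <= m%:R^-1 * u m + M / n%:R.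
  rewrite ler_pdivrMl// mulrDr [n%:R * (M / _)]mulrCA divff ?gt_eqF// mulr1.
  apply: (le_trans (uM n)); rewrite lerD2r mulrA ler_wpM2r//.
  by rewrite ler_pdivlMr// -natrM ler_nat leq_trunc_div.
rewrite ltr_norml; apply/andP; split; lra.
Unshelve. all: by end_near. Qed.

End Fekete.

(** * Digits *)

Section Digits.
Context {R : realType}.
Implicit Types (x z : circle R) (r : R).

Lemma trunc_mul_div (c : nat) r : (0 < c)%N -> 0 <= r ->
  (Num.trunc (c%:R * r) %/ c)%N = Num.trunc r.
Proof.
move=> c0 r0; have c0R : 0 < c%:R :> R by rewrite ltr0n.
have cr0 : 0 <= c%:R * r by rewrite mulr_ge0// ltW.
apply/esym/truncn_def; have /andP[h1 h2] := truncn_itv cr0.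
set m := Num.trunc _ in h1 h2 *; apply/andP; split.
  rewrite -(ler_pM2l c0R) -natrM; apply: le_trans h1.
  by rewrite ler_nat mulnC leq_trunc_div.
rewrite -(ltr_pM2l c0R) -natrM; apply: (lt_le_trans h2).
by rewrite ler_nat mulnC ltn_ceil.
Qed.

(** Bases are written [n.+2] in order that digits form a ring, in which the
    neighbours of a cell [w] are [w - 1] and [w + 1], also across the origin. *)
Definition digit n x : 'I_n.+2 := inord (Num.trunc (n.+2%:R * frac x)).

Lemma digit_val n x : digit n x = Num.trunc (n.+2%:R * frac x) :> nat.
Proof.
rewrite inordK// truncn_lt_nat ?mulr_ge0// ?frac_ge0//.
by rewrite gtr_pMr// frac_lt1.
Qed.

Lemma digit_pi n r : 0 <= r ->
  digit n (\pi_(circle R) r) = (Num.trunc (n.+2%:R * r) %% n.+2)%N :> nat.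
Proof.
move=> r0; have /andP[h1 h2] := truncn_itv r0.
set m := Num.trunc r in h1 h2.
have -> : \pi_(circle R) r = \pi_(circle R) (r - m%:R).
  by apply/pi_circle_eq; exists m; rewrite subrK.
have f0 : 0 <= r - m%:R by rewrite subr_ge0.
rewrite digit_val frac_pi; last first.
  by rewrite f0 /= ltrBlDr addrC natr1.
have -> : n.+2%:R * r = (n.+2 * m)%:R + n.+2%:R * (r - m%:R).
  by rewrite natrM; ring.
rewrite truncnD ?natr_nat ?nnegrE ?mulr_ge0// natrK mulnC modnMDl modn_small//.
rewrite truncn_lt_nat ?mulr_ge0// gtr_pMr//.
by rewrite ltrBlDr addrC natr1.
Qed.

Lemma measurable_digit n : measurable_partition (digit n).
Proof.
move=> i; have c0 : 0 < n.+2%:R :> R by rewrite ltr0n.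
rewrite (_ : _ @^-1` _ =
  [set x | frac x < i.+1%:R / n.+2%:R] `\` [set x | frac x < i%:R / n.+2%:R]).
  by apply: measurableD; exact: measurable_frac_lt.
apply/seteqP; split=> x /=.
  move=> <-; rewrite digit_val !ltr_pdivlMr// ![frac x * _]mulrC.
  have x0 : 0 <= n.+2%:R * frac x by rewrite mulr_ge0// frac_ge0.
  have /andP[h1 h2] := truncn_itv x0.
  by split=> //; apply/negP; rewrite -leNgt.
rewrite !ltr_pdivlMr// ![frac x * _]mulrC => -[h2 /negP]; rewrite -leNgt => h1.
by apply: val_inj; rewrite /= digit_val; apply: truncn_def; rewrite h1 h2.
Qed.

(** Most significant digit first: the digit of weight [a.+2 ^ (k - i.+1)] is the
    one that the orbit shows at time [i]. *)
Definition base_digits (a k : nat) (j : nat) : {ffun 'I_k -> 'I_a.+2} :=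
  [ffun i : 'I_k => inord (j %/ a.+2 ^ (k - i.+1) %% a.+2)].

Lemma base_digits_inj a k j l : (j < a.+2 ^ k)%N -> (l < a.+2 ^ k)%N ->
  base_digits a k j = base_digits a k l -> j = l.
Proof.
move=> jk lk /ffunP jl.
have {}jl i : (i < k)%N -> (j %/ a.+2 ^ i %% a.+2 = l %/ a.+2 ^ i %% a.+2)%N.
  move=> ik; have ik' : (k - i.+1 < k)%N by lia.
  have /(congr1 val) := jl (Ordinal ik'); rewrite !ffunE /= !inordK ?ltn_pmod//.
  by have -> : (k - (k - i.+1).+1 = i)%N by lia.
elim: k j l jk lk jl => [|k IH] j l.
  by rewrite expn0 !ltnS !leqn0 => /eqP-> /eqP->.
rewrite !expnSr -!ltn_divLR// => jk lk jl.
rewrite (divn_eq j a.+2) (divn_eq l a.+2); congr (_ * _ + _)%N.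
  apply: IH => // i ik; rewrite -!divnMA -!expnS.
  exact: (jl i.+1).
by have := jl 0%N isT; rewrite expn0 !divn1.
Qed.

Lemma iterated_join_digit a k n x : n.+2 = (a.+2 ^ k)%N ->
  iterated_join (times_map a.+2) (digit a) k x = base_digits a k (digit n x).
Proof.
move=> nk; apply/ffunP => i; rewrite !ffunE times_mapE.
have -> : x *+ a.+2 ^ i = \pi_(circle R) (frac x *+ a.+2 ^ i).
  by rewrite pi_circle_mulrn fracK.
apply: val_inj; rewrite /= inordK ?ltn_pmod// digit_pi; last first.
  by rewrite mulrn_wge0// frac_ge0.
congr (_ %% _)%N; rewrite digit_val nk.
have -> : (a.+2 ^ k = a.+2 ^ (k - i.+1) * a.+2 ^ i.+1)%N.
  by rewrite -expnD subnK.
rewrite natrM -mulrA trunc_mul_div ?expn_gt0// ?mulr_ge0// ?frac_ge0//.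
by rewrite expnS natrM -[frac x *+ _]mulr_natl mulrA.
Qed.

(** The join of [k] steps of the partition into arcs of length [1 / a] is the
    partition into arcs of length [1 / a ^ k]. By subadditivity the entropy of
    the former partition is a genuine limit, so that a bound on it is felt at
    every large [k]. *)
Lemma small_entropy_digit a (t e : R) (mu : probability (circle R) R) :
  measure_preserving mu (times_map a.+2) ->
  (entropy mu (times_map a.+2) <= t%:E)%E -> 0 < e ->
  \forall k \near \oo, forall n, n.+2 = (a.+2 ^ k)%N ->
    partition_entropy mu (digit n) < k%:R * (t + e).
Proof.
move=> muT ht e0; set T := times_map a.+2 in muT ht.
pose u n := partition_entropy mu (iterated_join T (digit a) n).
have mT : measurable_fun setT T := @measurable_times_map R a.+2.
have mjoin n : measurable_partition (iterated_join T (digit a) n).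
  by apply: measurable_iterated_join => //; exact: measurable_digit.
have cu : cvgn (fun n => n%:R^-1 * u n).
  apply: is_cvg_subadditive => [n|m n]; first exact: partition_entropy_ge0.
  by apply: partition_entropy_join_subadd => //; exact: measurable_digit.
have lu : limn (fun n => n%:R^-1 * u n) <= t.
  rewrite -lee_fin; apply: le_trans ht; apply: ereal_sup_ubound.
  by exists a.+2, (digit a); split => //; exact: measurable_digit.
have : \forall k \near \oo, k%:R^-1 * u k < t + e.
  move: cu => /cvgrPdist_lt /(_ e e0); apply: filterS => k.
  by rewrite ltr_norml => /andP[]; lra.
move=> h; near=> k => n nk.
have k0 : (0 < k)%N by near: k; exact: nbhs_infty_gt.
have <- : u k = partition_entropy mu (digit n).
  rewrite -(@partition_entropy_inj _ _ _ mu _ _ (base_digits a k \o val));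
    last first.
    by move=> i j /base_digits_inj ij; apply/val_inj/ij; rewrite -nk ltn_ord.
  rewrite /u; congr partition_entropy.
  by apply/funext => x; exact: iterated_join_digit.
by rewrite -ltr_pdivrMl ?ltr0n//; near: k.
Unshelve. all: by end_near. Qed.

End Digits.

(** * Continuous costs *)

Section SmoothedWeights.
Context {R : realType} (n : nat).
Implicit Types (z : circle R) (w : 'I_n.+2) (p : 'I_n.+2 -> R).

Definition cell_center w : circle R :=
  \pi_(circle R) ((w%:R + 2^-1) / n.+2%:R).

(** Weak* convergence is only informative about continuous functions, and the
    endpoints of the arcs may carry mass of the limit measure. This tent
    replaces the indicator function of the cell [w]: it is at least 1 on the
    cell and vanishes outside the cell and its two neighbours. *)
Definition hat w z : R :=
  Num.max 0 (3 / 2 - n.+2%:R * circle_dist z (cell_center w)).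

Lemma hat_ge0 w z : 0 <= hat w z.
Proof. by rewrite le_max lexx. Qed.

Lemma hat_le w z : hat w z <= 3 / 2.
Proof.
rewrite ge_max divr_ge0//= gerBl mulr_ge0//.
exact: circle_norm_ge0.
Qed.

Lemma hat_digit z : 1 <= hat (digit n z) z.
Proof.
rewrite le_max; apply/orP; right.
have c0 : 0 < n.+2%:R :> R by rewrite ltr0n.
have x0 : 0 <= n.+2%:R * frac z by rewrite mulr_ge0// frac_ge0.
have /andP[h1 h2] := truncn_itv x0.
suff : n.+2%:R * circle_dist z (cell_center (digit n z)) <= 2^-1 by lra.
rewrite -{1}(fracK z).
apply: (@le_trans _ _
  (n.+2%:R * `|frac z - ((digit n z)%:R + 2^-1) / n.+2%:R|)).
  by rewrite ler_wpM2l// circle_dist_pi.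
rewrite -[X in X * `|_|](gtr0_norm c0) -normrM mulrBr.
rewrite [_ * (_ / _)]mulrCA divff ?gt_eqF// mulr1 digit_val.
rewrite -[(Num.trunc _).+1%:R]natr1 in h2.
by rewrite ler_norml; apply/andP; split; lra.
Qed.

(** If the centre is at distance less than [3 / 2] after rescaling by the base,
    the cells differ by less than 2 modulo the base. *)
Lemma hat_support w z : 0 < hat w z ->
  [|| w == digit n z - 1, w == digit n z | w == digit n z + 1].
Proof.
rewrite lt_max ltxx /= subr_gt0 => hz.
have c0 : 0 < n.+2%:R :> R by rewrite ltr0n.
have x0 : 0 <= n.+2%:R * frac z by rewrite mulr_ge0// frac_ge0.
have /andP[h1 h2] := truncn_itv x0; 
rewrite -digit_val -[(nat_of_ord _).+1%:R]natr1 in h1 h2.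
move: hz; rewrite mulrC -ltr_pdivlMr// -{1}(fracK z).
move=> /circle_dist_lt[e].
rewrite ltr_pdivlMr// mulrC -[X in X * `|_|](gtr0_norm c0).
rewrite -normrM; move: (frac z) h1 h2 => r h1 h2.
have -> : n.+2%:R * (r - (w%:R + 2^-1) / n.+2%:R - e%:~R) =
  n.+2%:R * r - (w%:R + 2^-1) - n.+2%:R * e%:~R by field; rewrite gt_eqF.
rewrite ltr_norml => /andP[h3 h4].
set D := digit n z in h1 h2 *.
pose v : int := (D : nat)%:Z - (w : nat)%:Z - n.+2%:Z * e.
have vE : v%:~R = (D : nat)%:R - (w : nat)%:R - n.+2%:R * e%:~R :> R.
  by rewrite /v !rmorphB /= rmorphM.
have v1 : v%:~R < 2%:~R :> R by rewrite vE; lra.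
have v2 : (-2)%:~R < v%:~R :> R by rewrite vE rmorphN /=; lra.
rewrite !ltr_int in v1 v2.
have vZ : v%:~R = D - w :> 'I_n.+2.
  rewrite /v !rmorphB /= rmorphM /= -!pmulrn !natr_Zp.
  have -> : n.+2%:R = 0 :> 'I_n.+2 by exact: (@pchar_Zp n.+2).
  by rewrite mul0r subr0.
have wD : w = D - v%:~R by rewrite vZ opprB addrC subrK.
have /or3P[] : [|| v == 1, v == 0 | v == -1] by lia.
- by move=> /eqP v1'; rewrite {1}wD v1' eqxx.
- by move=> /eqP v1'; rewrite {2}wD v1' subr0 eqxx orbT.
- by move=> /eqP v1'; rewrite {3}wD v1' rmorphN opprK eqxx !orbT.
Qed.

(** The tents have height [3 / 2] and at most three of them overlap; the factor
    [2 / 9] is thus what makes [smooth p] bounded by [blur p] of the digit. *)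
Definition smooth p z : R := 2 / 9 * \sum_w p w * hat w z.

Definition blur p w : R := (p (w - 1) + p w + p (w + 1)) / 3.

(** A continuous substitute for the information [- ln (p w)] of the cell [w]
    containing the point. It exceeds the information for the blurred weights,
    which are still weights and serve to count words, and it exceeds the
    information for [p] itself by at most [ln (9 / 2)], which serves to compare
    its integral with an entropy. *)
Definition cost p z : R := - ln (smooth p z).

Lemma sum_blur p : \sum_w blur p w = \sum_w p w.
Proof.
rewrite -mulr_suml !big_split /=.
have shift (v : 'I_n.+2) : \sum_w p (w + v) = \sum_w p w.
  by rewrite [RHS](reindex_inj (addIr v)).
by rewrite (shift (-1)) (shift 1); lra.
Qed.

Lemma smooth_le p z : (forall w, 0 <= p w) ->
  smooth p z <= blur p (digit n z).
Proof.
move=> p0; set D := digit n z.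
have delta v : \sum_w p w * (w == v)%:R = p v.
  rewrite (bigD1 v)//= eqxx mulr1 big1 ?addr0// => w /negPf->.
  by rewrite mulr0.
suff : \sum_w p w * hat w z <= 3 / 2 * (p (D - 1) + p D + p (D + 1)).
  by rewrite /smooth /blur; lra.
rewrite -(delta (D - 1)) -(delta D) -(delta (D + 1)) -!big_split mulr_sumr /=.
apply: ler_sum => w _; rewrite -!mulrDr mulrCA ler_wpM2l//.
have [h0|] := leP (hat w z) 0.
  by rewrite (le_trans h0)// mulr_ge0// !addr_ge0.
move=> /hat_support; rewrite -/D => hs; apply: (le_trans (hat_le w z)).
rewrite -{1}[3 / 2]mulr1 ler_wpM2l// -!natrD ler1n.
by move: hs => /or3P[] ->; rewrite ?addnS//= addn_gt0 ?orbT.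
Qed.

Lemma smooth_ge p z : (forall w, 0 <= p w) ->
  2 / 9 * p (digit n z) <= smooth p z.
Proof.
move=> p0; rewrite /smooth ler_wpM2l// (bigD1 (digit n z))//=.
have h := ler_wpM2l (p0 (digit n z)) (hat_digit z); rewrite mulr1 in h.
by rewrite (le_trans h)// lerDl sumr_ge0// => w _; rewrite mulr_ge0// hat_ge0.
Qed.

Lemma continuous_hat w : continuous (hat w).
Proof.
pose g (u : R) : R := Num.max 0 (3 / 2 - n.+2%:R * u).
have cg : continuous g.
  have -> : g = (fun=> 0) \max (fun u => 3 / 2 - n.+2%:R * u) by [].
  move=> u; apply: continuous_max; first exact: cvg_cst.
  apply: continuousB; first exact: cvg_cst.
  by apply: continuousM; [exact: cvg_cst|exact: cvg_id].
move=> z; apply: (@continuous_comp (circle R) R R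
  (circle_dist^~ (cell_center w)) g).
  exact: continuous_circle_dist.
exact: cg.
Qed.

Lemma continuous_smooth p : continuous (smooth p).
Proof.
have cvg_linear (T : topologicalType) (h : 'I_n.+2 -> T -> R) :
    (forall w, continuous (h w)) ->
    continuous (fun x => 2 / 9 * \sum_w p w * h w x).
  move=> ch x; apply: cvgM; first exact: cvg_cst.
  apply: cvg_big => [|w _].
    exact: pseudometric_normed_Zmodule.add_continuous.
  apply: cvgM; first exact: cvg_cst.
  exact: ch.
exact: (cvg_linear _ hat continuous_hat).
Qed.

Section Positive.
Variable p : 'I_n.+2 -> R.
Hypotheses (p0 : forall w, 0 < p w) (p1 : \sum_w p w <= 1).

Let p_ge0 w : 0 <= p w. Proof. exact: ltW. Qed.

Lemma smooth_gt0 z : 0 < smooth p z.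
Proof. by apply: lt_le_trans (smooth_ge z p_ge0); rewrite mulr_gt0. Qed.

Lemma blur_gt0 w : 0 < blur p w.
Proof. by rewrite divr_gt0// !addr_gt0. Qed.

Lemma continuous_cost : continuous (cost p).
Proof.
move=> z; apply: (@continuous_comp (circle R) R R (smooth p) (fun u => - ln u)).
  exact: continuous_smooth.
by apply: continuousN; apply: continuous_ln; exact: smooth_gt0.
Qed.

Lemma cost_ge0 z : 0 <= cost p z.
Proof.
rewrite oppr_ge0 ln_le0// (le_trans (smooth_le _ _))// /blur.
have pw w : p w <= 1.
  by rewrite (le_trans _ p1)// (bigD1 w)//= lerDl sumr_ge0.
by have := pw (digit n z - 1); have := pw (digit n z);
   have := pw (digit n z + 1); lra.
Qed.

Lemma cost_ge z : - ln (blur p (digit n z)) <= cost p z.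
Proof.
by rewrite lerN2 ler_ln ?posrE ?smooth_gt0 ?blur_gt0// smooth_le.
Qed.

Lemma cost_le z : cost p z <= ln (9 / 2) - ln (p (digit n z)).
Proof.
rewrite -ln_div ?posrE// /cost -lnV ?posrE ?smooth_gt0//.
rewrite ler_ln ?posrE ?invr_gt0 ?smooth_gt0 ?divr_gt0//.
have -> : 9 / 2 / p (digit n z) = (2 / 9 * p (digit n z))^-1.
  by rewrite invfM invf_div.
by rewrite lef_pV2 ?posrE ?smooth_gt0 ?mulr_gt0// smooth_ge.
Qed.
End Positive.

End SmoothedWeights.

(** * Counting and covering *)

Section Counting.
Context {R : realType}.

Lemma sum_ord_mul (F : nat -> R) N c :
  \sum_(j < N * c) F j = \sum_(i < N) \sum_(d < c) F (i * c + d)%N.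
Proof.
elim: N => [|N IH]; first by rewrite mul0n !big_ord0.
rewrite big_ord_recr /= -IH -!(big_mkord xpredT) mulSn addnC.
rewrite (big_cat_nat (n := (N * c)%N)) ?leq_addr//=; congr (_ + _).
rewrite -{1}[(N * c)%N]add0n big_addn addKn !big_mkord.
by apply: eq_bigr => i _; rewrite addnC.
Qed.

Variable n : nat.
Variable q : 'I_n.+2 -> R.
Hypotheses (q0 : forall w, 0 < q w) (q1 : \sum_w q w <= 1).

(** The mass given by the product measure with marginals [q] to the word formed
    by the last [L] digits of [j] in base [n.+2]. *)
Definition weight L (j : nat) : R :=
  \prod_(i < L) q (inord (j %/ n.+2 ^ i %% n.+2)).

Lemma weight_gt0 L j : 0 < weight L j.
Proof. by apply: prodr_gt0. Qed.

(** Each word of length [L] consists of the last [L] digits of exactly [M] of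
    these integers. *)
Lemma sum_weight L M : \sum_(j < M * n.+2 ^ L) weight L j <= M%:R.
Proof.
elim: L => [|L IH].
  rewrite expn0 muln1 (eq_bigr (fun=> 1)) ?sumr_const ?card_ord// => j _.
  by rewrite /weight big_ord0.
rewrite expnSr mulnA sum_ord_mul; apply: le_trans IH.
apply: ler_sum => i _.
rewrite (eq_bigr (fun d : 'I_n.+2 => q d * weight L i)).
  by rewrite -mulr_suml ler_piMl// ltW// weight_gt0.
move=> d _; rewrite /weight big_ord_recl expn0 divn1 modnMDl modn_small//.
rewrite inord_val; congr (_ * _); apply: eq_bigr => l _.
by rewrite /= /bump add1n expnS divnMA divnMDl// [(d %/ _)%N]divn_small// addn0.
Qed.

(** Markov's inequality, the total weight being at most [M]. *)
Lemma card_heavy L M (C : R) :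
  #|[pred j : 'I_(M * n.+2 ^ L) | expR (- C) <= weight L j]|%:R <=
  M%:R * expR C.
Proof.
rewrite -ler_pdivrMr ?expR_gt0// -expRN; apply: le_trans (sum_weight L M).
rewrite (bigID (fun j : 'I__ => expR (- C) <= weight L j))/=.
apply: (@le_trans _ _
  (\sum_(j < M * n.+2 ^ L | expR (- C) <= weight L j) expR (- C))).
  by rewrite sumr_const mulr_natl.
rewrite -[leLHS]addr0 lerD ?ler_sum ?sumr_ge0// => j _.
by rewrite ltW// weight_gt0.
Qed.

(** Multiplying by [M] shifts the expansion of [x], and the integer part of
    [M * n.+2 ^ L * x] keeps [L] further digits. They are the digits shown by
    the orbit of [M * x], the last one being the least significant. *)
Lemma weight_digits (x : circle R) M L :
  weight L (Num.trunc ((M * n.+2 ^ L)%:R * frac x)) =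
  \prod_(i < L) q (digit n (x *+ (M * n.+2 ^ i))).
Proof.
rewrite /weight (reindex_inj rev_ord_inj) /=; apply: eq_bigr => i _.
congr q; apply: val_inj; rewrite /= inordK ?ltn_pmod//.
rewrite -[x in RHS]fracK -pi_circle_mulrn digit_pi ?mulrn_wge0 ?frac_ge0//.
congr (_ %% _)%N.
have -> : (n.+2 ^ L = n.+2 ^ (L - i.+1) * n.+2 ^ i.+1)%N.
  by rewrite -expnD subnK.
rewrite mulnCA natrM -mulrA trunc_mul_div ?expn_gt0//; last first.
  by rewrite mulr_ge0// frac_ge0.
by rewrite expnS mulnCA natrM -mulrA -[frac x *+ _]mulr_natl.
Qed.

Variable f : circle R -> R.
Hypotheses (f_ge : forall z, - ln (q (digit n z)) <= f z).

Lemma weight_ge (x : circle R) M L C :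
  \sum_(i < L) f (x *+ (M * n.+2 ^ i)) <= C ->
  expR (- C) <= weight L (Num.trunc ((M * n.+2 ^ L)%:R * frac x)).
Proof.
move=> fC; rewrite weight_digits.
rewrite (eq_bigr (fun i : 'I_L =>
    expR (ln (q (digit n (x *+ (M * n.+2 ^ i))))))); last first.
  by move=> i _; rewrite lnK// posrE.
rewrite -expR_sum ler_expR lerNl -sumrN; apply: le_trans fC.
exact: ler_sum.
Qed.

End Counting.

Section Arcs.
Context {R : realType}.
Local Open Scope ereal_scope.

Definition arc (Q j : nat) : set (circle R) :=
  [set x | Num.trunc (Q%:R * frac x)%R = j].

Lemma diam_arc Q j : (0 < Q)%N -> diam (arc Q j) <= (Q%:R^-1)%:E.
Proof.
move=> Q0; rewrite ge_max lee_fin invr_ge0 ler0n /=.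
apply: ge_ereal_sup => _ [[x y] [/= xj yj] <-]; rewrite lee_fin.
have Q0R : (0 < Q%:R :> R)%R by rewrite ltr0n.
have trep (z : circle R) : Num.trunc (Q%:R * frac z)%R = j ->
    (j%:R <= Q%:R * frac z < j%:R + 1)%R.
  move=> <-; rewrite natr1 /=.
  by apply: truncn_itv; rewrite mulr_ge0// frac_ge0.
have /andP[x1 x2] := trep _ xj; have /andP[y1 y2] := trep _ yj.
rewrite mdist_circleE -(fracK x) -(fracK y).
apply: (le_trans (circle_dist_pi _ _)).
rewrite -(ler_pM2l Q0R) divff ?gt_eqF// -[X in (X * `|_|)%R](gtr0_norm Q0R).
by rewrite -normrM mulrBr ler_norml; apply/andP; split; lra.
Qed.

Lemma gauge_arc s Q j : (0 < Q)%N -> (0 <= s)%R ->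
  hausdorff_gauge s (arc Q j) <= (expR (- s * ln Q%:R))%:E.
Proof.
move=> Q0 s0; rewrite /hausdorff_gauge.
case: ifP => _; first by rewrite lee_fin expR_ge0.
apply: (@le_trans _ _ ((Q%:R^-1)%:E `^ s)).
  apply: gt0_ler_poweR => //; rewrite ?in_itv/= ?diam_ge0 ?leey//.
    by rewrite lee_fin invr_ge0 ler0n.
  exact: diam_arc.
rewrite poweR_EFin lee_fin /powR gt_eqF ?invr_gt0 ?ltr0n//.
by rewrite lnV ?posrE ?ltr0n// mulrN mulNr.
Qed.

End Arcs.

(** Since [f] is nonnegative, restricting to the rows [l <= th * N] multiplies
    averages by at most [1 / th]; some row, along some residue class modulo [k],
    does not exceed the average. *)
Lemma pigeonhole_row (R : realType) (f : nat -> nat -> R) (N k : nat)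
    (th eta : R) :
  (forall m l, 0 <= f m l) -> (0 < N)%N -> (0 < k)%N ->
  0 < th < 1 -> 0 <= eta ->
  \sum_(m < N) \sum_(l < N) f m l <= N%:R ^+ 2 * (k%:R * eta) ->
  exists l r, [/\ l%:R <= th * N%:R, (r < k)%N &
    \sum_(i < N %/ k) f (i * k + r)%N l <= N%:R * eta / th].
Proof.
move=> f0 N0 k0 /andP[th0 th1] eta0 fN; apply: contrapT => no.
have N0R : 0 < N%:R :> R by rewrite ltr0n.
have thN0 : 0 <= th * N%:R by rewrite mulr_ge0// ltW.
(* the number of rows kept: it is at least [th * N], while the indices below it
   are at most [th * N] *)
pose Z := (Num.trunc (th * N%:R)).+1.
have ZN : (Z <= N)%N by rewrite truncn_lt_nat// gtr_pMl.
have /andP[Z1 Z2] := truncn_itv thN0.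
have big l r : (l < Z)%N -> (r < k)%N ->
    N%:R * eta / th < \sum_(i < N %/ k) f (i * k + r)%N l.
  move=> lZ rk; rewrite ltNge; apply/negP => h; apply: no; exists l, r.
  by split => //; apply: le_trans Z1; rewrite ler_nat.
have row l : \sum_(r < k) \sum_(i < N %/ k) f (i * k + r)%N l <=
    \sum_(m < N) f m l.
  rewrite exchange_big -(sum_ord_mul (f^~ l)) /=.
  rewrite -!(big_mkord xpredT (f^~ l)).
  rewrite [leRHS](big_cat_nat (n := (N %/ k * k)%N)) ?leq_trunc_div//=.
  by rewrite lerDl sumr_ge0.
have : \sum_(l < Z) \sum_(r < k) (N%:R * eta / th) <
    \sum_(l < Z) \sum_(r < k) \sum_(i < N %/ k) f (i * k + r)%N l.
  apply: ltr_sum; first by apply/hasP; exists ord0; rewrite ?mem_index_enum.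
  move=> l _; apply: ltr_sum => [|r _]; last exact: big.
  by apply/hasP; exists (Ordinal k0); rewrite ?mem_index_enum.
rewrite ltNge => /negP; apply.
apply: (@le_trans _ _ (\sum_(l < Z) \sum_(m < N) f m l)).
  by apply: ler_sum => l _; exact: row.
apply: (@le_trans _ _ (\sum_(l < N) \sum_(m < N) f m l)).
  rewrite -!(big_mkord xpredT (fun l => \sum_(m < N) f m l)).
  rewrite [leRHS](big_cat_nat (n := Z))//= lerDl sumr_ge0// => l _.
  exact: sumr_ge0.
rewrite exchange_big; apply: (le_trans fN).
rewrite !sumr_const !card_ord -mulrnA -[leRHS]mulr_natr natrM.
have -> : N%:R * eta / th * (k%:R * Z%:R) = N%:R * (k%:R * eta) * (Z%:R / th).
  by rewrite -!mulrA; congr (_ * _); rewrite mulrCA; ring.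
rewrite expr2 mulrAC ler_wpM2l ?mulr_ge0//.
by rewrite ler_pdivlMr// mulrC ltW.
Qed.

Section Covering.
Context {R : realType}.
Variables (a b k n : nat).
Hypotheses (a2 : (2 <= a)%N) (b1 : (1 <= b)%N) (k0 : (0 < k)%N).
Hypothesis nk : n.+2 = (a ^ k)%N.
Variable q : 'I_n.+2 -> R.
Hypotheses (q0 : forall w, 0 < q w) (q1 : \sum_w q w <= 1).
Variable f : circle R -> R.
Hypotheses (f0 : forall z, 0 <= f z)
  (f_ge : forall z, - ln (q (digit n z)) <= f z).

Definition low_cost (eta : R) (N : nat) : set (circle R) :=
  [set x | \sum_(m < N) \sum_(l < N) f (x *+ (a ^ m * b ^ l)) <=
    N%:R ^+ 2 * (k%:R * eta)].

Variables (s th eta kappa : R).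
Hypotheses (s01 : 0 <= s <= 1) (th01 : 0 < th < 1) (eta0 : 0 <= eta).
Hypothesis rate :
  (1 - s) * th * ln b%:R + eta / th - s * ln a%:R <= - kappa.

(** Number of arcs times gauge of an arc, for the row [l] and the class [r].
    Because [s <= 1], the bound is worst for the largest row [l = th * N], where
    [rate] applies; the class [r < k] and the remainder of [N] modulo [k] cost
    a factor [a ^ k] that does not depend on [N]. *)
Lemma scale_gauge_bound N l r :
  (r < k)%N -> l%:R <= th * N%:R ->
  (a ^ r * b ^ l)%:R * expR (N%:R * eta / th) *
    expR (- s * ln (a ^ r * b ^ l * n.+2 ^ (N %/ k))%:R) <=
  expR (k%:R * ln a%:R) * expR (- kappa * N%:R) :> R.
Proof.
move=> rk lN; have /andP[s0 s1] := s01; have /andP[th0 th1] := th01.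
have aR : 0 < a%:R :> R by rewrite ltr0n ltnW.
have bR : 0 < b%:R :> R by rewrite ltr0n.
have A0 : 0 <= ln a%:R :> R by rewrite ln_ge0// ler1n ltnW.
have B0 : 0 <= ln b%:R :> R by rewrite ln_ge0// ler1n.
set L := (N %/ k)%N.
have lnab : ln (a ^ r * b ^ l)%:R = r%:R * ln a%:R + l%:R * ln b%:R :> R.
  rewrite natrM !natrX lnM ?posrE ?exprn_gt0// !lnXn//.
  by rewrite !mulr_natl.
have M0 : 0 < (a ^ r * b ^ l)%:R :> R.
  by rewrite ltr0n muln_gt0 !expn_gt0 b1 (ltnW a2).
have lnQ : ln (a ^ r * b ^ l * n.+2 ^ L)%:R =
    r%:R * ln a%:R + l%:R * ln b%:R + (k * L)%:R * ln a%:R :> R.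
  rewrite nk -expnM [(_ * a ^ (k * L))%:R]natrM lnM ?posrE//; last first.
    by rewrite ltr0n expn_gt0 (ltnW a2).
  by rewrite lnab natrX lnXn// [(k * L)%:R * _]mulr_natl.
rewrite lnQ -[X in X * _ * _](lnK (M0 : _ \is Num.pos)) lnab -!expRD ler_expR.
have kL : N%:R - k%:R <= (k * L)%:R :> R.
  rewrite lerBlDr -natrD ler_nat {1}(divn_eq N k) mulnC leq_add2l.
  by rewrite ltnW// ltn_pmod.
have rkR : r%:R <= k%:R :> R by rewrite ler_nat ltnW.
have h1 : (1 - s) * (r%:R * ln a%:R) <= (1 - s) * (k%:R * ln a%:R).
  by rewrite ler_wpM2l ?subr_ge0// ler_wpM2r.
have h2 : (1 - s) * (l%:R * ln b%:R) <= (1 - s) * (th * N%:R * ln b%:R).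
  by rewrite ler_wpM2l ?subr_ge0// ler_wpM2r.
have h3 : s * ((N%:R - k%:R) * ln a%:R) <= s * ((k * L)%:R * ln a%:R).
  by rewrite ler_wpM2l// ler_wpM2r.
have h4 := ler_wpM2r (ler0n R N) rate.
have -> : N%:R * eta / th = eta / th * N%:R by rewrite -mulrA mulrC.
move: (eta / th) (ln a%:R) (ln b%:R) h1 h2 h3 h4 => u A B h1 h2 h3 h4.
lra.
Qed.

(** With [M = a ^ r * b ^ l], a low sum of costs along the orbit of [M * x]
    means that the word shown by this orbit is heavy; [x] then lies in one of
    the arcs of length [1 / (M * n.+2 ^ L)] whose index ends with a heavy word. *)
Lemma hausdorff_pre_low_cost N d : (0 < N)%N -> 0 <= d ->
  (a ^ (N - k))%:R^-1 <= d ->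
  (hausdorff_pre s d (low_cost eta N) <=
   ((N * k)%:R * (expR (k%:R * ln a%:R) * expR (- kappa * N%:R)))%:E)%E.
Proof.
move=> N0 d0 ad; set C := N%:R * eta / th; set L := (N %/ k)%N.
have a0 : (0 < a)%N := ltnW a2.
pose M (lr : 'I_N * 'I_k) := (a ^ lr.2 * b ^ lr.1)%N.
pose Q lr := (M lr * n.+2 ^ L)%N.
have M0 lr : (0 < M lr)%N by rewrite muln_gt0 !expn_gt0 a0 b1.
have Q0 lr : (0 < Q lr)%N by rewrite muln_gt0 M0 expn_gt0.
pose heavy lr (j : 'I_(Q lr)) := expR (- C) <= weight q L j.
pose short (lr : 'I_N * 'I_k) := lr.1%:R <= th * N%:R.
pose I : finType := {lr : 'I_N * 'I_k & 'I_(Q lr)}.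
pose P (p : I) := short (tag p) && heavy (tag p) (tagged p).
have s0 : 0 <= s by case/andP: s01.
apply: (le_trans (@hausdorff_pre_fin _ _ s d I P
    (fun p => arc (Q (tag p)) (tagged p)) _ _ d0 _)).
- move=> [lr j] _ /=; apply: (le_trans (diam_arc _ (Q0 lr))); rewrite lee_fin.
  apply: le_trans ad; rewrite lef_pV2 ?posrE ?ltr0n ?expn_gt0 ?a0//.
  rewrite ler_nat /Q nk -expnM -[leqLHS]mul1n leq_mul// leq_exp2l//.
  by rewrite leq_subLR mulnC {1}(divn_eq N k) addnC leq_add2r ltnW// ltn_pmod.
- move=> x xN.
  have [|l [r [lN rk fC]]] := pigeonhole_row
      (f := fun m l => f (x *+ (a ^ m * b ^ l))) _
      N0 k0 th01 eta0 xN; first by [].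
  have lN' : (l < N)%N.
    rewrite -(ltr_nat R); apply: (le_lt_trans lN).
    by rewrite gtr_pMl ?ltr0n//; case/andP: th01.
  pose lr := (Ordinal lN', Ordinal rk).
  have jQ : (Num.trunc ((Q lr)%:R * frac x)%R < Q lr)%N.
    rewrite truncn_lt_nat ?mulr_ge0 ?frac_ge0//.
    by rewrite gtr_pMr ?ltr0n// frac_lt1.
  exists (existT _ lr (Ordinal jQ)) => //=; rewrite /P /short /= lN /=.
  apply: (weight_ge q0 f_ge); apply: le_trans fC; rewrite le_eqVlt.
  apply/orP; left; apply/eqP; apply: eq_bigr => i _; congr (f (_ *+ _)).
  by rewrite /M /= nk -expnM mulnAC -expnD addnC [(k * i)%N]mulnC.
apply: (@le_trans _ _
  (\sum_(p : I | P p) (expR (- s * ln (Q (tag p))%:R))%:E)%E).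
  by apply: lee_sum => p _; exact: gauge_arc.
rewrite sumEFin lee_fin.
have -> : \sum_(p : I | P p) expR (- s * ln (Q (tag p))%:R) =
    \sum_(lr | short lr) \sum_(j | heavy lr j) expR (- s * ln (Q lr)%:R).
  by rewrite sig_big_dep.
apply: (@le_trans _ _ (\sum_(lr | short lr)
    (expR (k%:R * ln a%:R) * expR (- kappa * N%:R)))).
  apply: ler_sum => lr slr; rewrite sumr_const -[leLHS]mulr_natl.
  apply: le_trans (scale_gauge_bound (ltn_ord lr.2) slr).
  rewrite ler_wpM2r ?expR_ge0//.
  exact: (card_heavy q0 q1 L (M lr) C).
rewrite sumr_const -[leLHS]mulr_natl ler_wpM2r ?mulr_ge0 ?expR_ge0// ler_nat.
by apply: (leq_trans (max_card _)); rewrite card_prod !card_ord.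
Qed.

Hypothesis kappa0 : 0 < kappa.

(** Half of the exponential decay absorbs the factor [N] that counts the rows,
    by [1 + u <= expR u]. *)
Lemma hausdorff_null_low_cost :
  hausdorff_measure s
    [set x | forall N0, exists2 N, (N0 <= N)%N & low_cost eta N x] = 0%E.
Proof.
pose K : R := expR (k%:R * ln a%:R).
apply: (@hausdorff_null_limsup _ _ s (low_cost eta) (2 / kappa * k%:R * K)
  (expR (- (kappa / 2)))).
- by rewrite !mulr_ge0 ?expR_ge0// invr_ge0 ltW.
- by rewrite expR_gt0 expR_lt1 oppr_lt0 divr_gt0.
move=> d d0; near=> N.
have N0 : (0 < N)%N by near: N; exact: nbhs_infty_gt.
have Nd : k%:R + d^-1 < N%:R by near: N; exact: nbhs_infty_gtr.
have di : 0 < d^-1 by rewrite invr_gt0.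
have kN : (k <= N)%N by rewrite -(ler_nat R); lra.
apply: (le_trans (hausdorff_pre_low_cost N0 (ltW d0) _)).
  rewrite -[leRHS]invrK lef_pV2 ?posrE ?ltr0n ?expn_gt0 ?(ltnW a2)//.
  apply: (@le_trans _ _ (N - k)%:R); first by rewrite natrB//; lra.
  by rewrite ler_nat ltnW// ltn_expl.
rewrite lee_fin -expRM_natl -/K natrM.
have -> : - kappa * N%:R = - (kappa / 2) * N%:R + - (kappa / 2) * N%:R by lra.
rewrite expRD.
have h : N%:R * expR (- (kappa / 2) * N%:R) <= 2 / kappa.
  have := expR_ge1Dx (kappa / 2 * N%:R).
  rewrite mulNr expRN => h; rewrite ler_pdivrMr ?expR_gt0//.
  rewrite -ler_pdivrMl ?divr_gt0// invf_div; lra.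
set E := expR _ in h *.
have -> : N%:R * k%:R * (K * (E * E)) = (N%:R * E) * (k%:R * K * E) by ring.
rewrite [N%:R * - _]mulrC -[2 / kappa * _ * _]mulrA -[leRHS]mulrA.
by rewrite ler_wpM2r// !mulr_ge0 ?expR_ge0.
Unshelve. all: by end_near. Qed.

End Covering.

(** * Weak* convergence *)

Section WeakConvergence.
Context {R : realType}.
Implicit Types (x : circle R) (f : circle R -> R).

Lemma weak_cvg_integral (mu_ : nat -> probability (circle R) R)
    (mu : probability (circle R) R) f : continuous f ->
  (fun i => mu_ i : borel_prob R) @ \oo --> (mu : borel_prob R) ->
  (\int[mu_ i]_x f x)%R @[i --> \oo] --> (\int[mu]_x f x)%R.
Proof.
move=> cf mucvg; pose g : continuousType (circle R) R := mkcts cf.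
have ci := @initial_continuous _ _ (@integrals R) (mu : borel_prob R).
have h : integrals (mu_ i) @[i --> \oo] --> (integrals mu : {ptws _ -> _}).
  exact: (cvg_comp _ _ mucvg ci).
have pc : continuous (fun u : {ptws continuousType (circle R) R -> R} => u g).
  exact: (@proj_continuous _ (fun=> R) g).
exact: (cvg_comp _ _ h (pc (integrals mu))).
Qed.

Lemma integral_empirical a b x N f : continuous f -> (forall z, 0 <= f z) ->
  (\int[empirical_prob a b x N]_z f z)%R =
  N.+1%:R ^- 2 * \sum_(m < N.+1) \sum_(l < N.+1) f (x *+ (a ^ m * b ^ l)).
Proof.
move=> cf f0.
have mf : measurable_fun [set: circle R] (EFin \o f).
  by apply/measurable_EFinP; exact: continuous_circle_measurable.
have f0E z : setT z -> (0 <= (f z)%:E)%E by rewrite lee_fin.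
have row m : (\int[msum (fun l => \d_(orbit_point a b m l x)) N.+1]_z (f z)%:E =
    (\sum_(l < N.+1) f (x *+ (a ^ m * b ^ l)))%:E)%E.
  rewrite ge0_integral_measure_sum// -sumEFin; apply: eq_bigr => l _.
  by rewrite integral_dirac// diracT mul1e orbit_pointE.
rewrite /Rintegral /empirical_prob /empirical.
rewrite (@ge0_integral_mscale _ _ _ _ _ measurableT)//=.
rewrite ge0_integral_measure_sum//.
rewrite (eq_bigr (fun m : 'I_N.+1 =>
  (\sum_(l < N.+1) f (x *+ (a ^ m * b ^ l)))%:E)) => [|m _]; last exact: row.
by rewrite sumEFin.
Qed.

Lemma integral_le_cells n (mu : probability (circle R) R) f (g : 'I_n.+2 -> R) :
  continuous f -> (forall z, 0 <= f z) -> (forall z, f z <= g (digit n z)) ->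
  (forall w, 0 <= g w) ->
  (\int[mu]_z f z)%R <= \sum_w prob mu (digit n @^-1` [set w]) * g w.
Proof.
move=> cf f0 fg g0.
have mcell w : measurable (digit n @^-1` [set w] : set (circle R)).
  exact: measurable_digit.
have mf := continuous_circle_measurable cf.
pose G w (z : circle R) : \bar R := (g w * \1_(digit n @^-1` [set w]) z)%:E.
have mG w : measurable_fun setT (G w).
  by apply/measurable_EFinP; apply: measurable_funM.
have G0 w z : setT z -> (0 <= G w z)%E by rewrite lee_fin mulr_ge0.
have GE z : (\sum_w G w z)%E = (g (digit n z))%:E.
  rewrite (bigD1 (digit n z))//= big1 ?adde0 => [|w wz].
    by rewrite /G indicE mem_set//= mulr1.
  rewrite /G indicE memNset ?mulr0// => /= zw.
  by rewrite zw eqxx in wz.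
have le : (\int[mu]_z (f z)%:E <=
    (\sum_w prob mu (digit n @^-1` [set w]) * g w)%:E)%E.
  apply: (@le_trans _ _ (\int[mu]_z (\sum_w G w z))%E).
    apply: ge0_le_integral => //.
    - by move=> z _; rewrite lee_fin.
    - by apply/measurable_EFinP.
    - exact: emeasurable_sum.
    - by move=> z _; rewrite GE lee_fin.
  rewrite ge0_integral_sum// -sumEFin; apply: lee_sum => w _.
  rewrite /G; under eq_integral do rewrite EFinM.
  rewrite ge0_integralZl_EFin//; last first.
    by apply/measurable_EFinP; exact: measurable_indic.
  rewrite integral_indic// setIT muleC EFinM /prob fineK//.
  exact: fin_num_measure.
rewrite /Rintegral -lee_fin fineK//.
rewrite ge0_fin_numE; last by apply: integral_ge0 => z _; rewrite lee_fin.
exact: (le_lt_trans le (ltry _)).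
Qed.

End WeakConvergence.

(** * From small entropy to low cost *)

Section Quantization.
Context {R : realType} (n : nat).

(** Weights with finitely many possible values: the costs built from them form a
    countable family, although the limit measures do not. *)
Definition quant (v : {ffun 'I_n.+2 -> 'I_n.+3}) (w : 'I_n.+2) : R :=
  (v w).+1%:R / (2 * n.+2%:R).

Lemma quant_gt0 v w : 0 < quant v w.
Proof. by rewrite divr_gt0// mulr_gt0. Qed.

(** Rounding [n.+2 * P w] down and adding 1 keeps the weights positive and above
    [P w]; the total is then at most 2, whence the halving. *)
Lemma quantize (P : 'I_n.+2 -> R) : (forall w, 0 <= P w) -> \sum_w P w = 1 ->
  exists2 v, \sum_w quant v w <= 1 & forall w, P w / 2 <= quant v w.
Proof.
move=> P0 P1.
have c0 : 0 < n.+2%:R :> R by rewrite ltr0n.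
have Pw1 w : P w <= 1 by rewrite -P1 (bigD1 w)//= lerDl sumr_ge0.
have cP0 w : 0 <= n.+2%:R * P w by rewrite mulr_ge0.
pose v := [ffun w => inord (Num.trunc (n.+2%:R * P w)) : 'I_n.+3].
have vE w : v w = Num.trunc (n.+2%:R * P w) :> nat.
  rewrite ffunE inordK// truncn_lt_nat// (@le_lt_trans _ _ n.+2%:R) ?ltr_nat//.
  by rewrite ger_pMr.
have v1 w : (v w)%:R <= n.+2%:R * P w by rewrite vE truncn_le.
have v2 w : n.+2%:R * P w <= (v w).+1%:R by rewrite vE ltW// truncnS_gt.
exists v => [|w]; last first.
  by rewrite ler_pdivlMr ?mulr_gt0// mulrA divfK// mulrC.
rewrite -mulr_suml ler_pdivrMr ?mulr_gt0// mul1r.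
apply: (@le_trans _ _ (\sum_w (n.+2%:R * P w + 1))).
  by apply: ler_sum => w _; rewrite -natr1 lerD2r.
rewrite big_split /= -mulr_sumr P1 sumr_const card_ord.
by rewrite mulr1 mulr_natl mulr2n.
Qed.

(** [ln 9] is the loss [ln 2] from quantization plus [ln (9 / 2)] from
    smoothing; it does not depend on [n]. *)
Lemma integral_cost (mu : probability (circle R) R) v :
  \sum_w quant v w <= 1 ->
  (forall w, prob mu (digit n @^-1` [set w]) / 2 <= quant v w) ->
  (\int[mu]_z cost (quant v) z)%R <= partition_entropy mu (digit n) + ln 9.
Proof.
move=> q1 Pq; pose P w := prob mu (digit n @^-1` [set w]).
have q0 := quant_gt0 v.
have P1 : \sum_w P w = 1.
  rewrite -(prob_setT mu) (prob_split mu (@measurable_digit R n) measurableT).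
  by apply: eq_bigr => w _; rewrite setTI.
apply: (le_trans (@integral_le_cells _ _ _ _
  (fun w => ln (9 / 2) - ln (quant v w)) _ _ _ _)).
- exact: continuous_cost.
- exact: cost_ge0.
- by move=> z; exact: cost_le.
- move=> w; rewrite subr_ge0; apply: (@le_trans _ _ 0).
    rewrite ln_le0// (le_trans _ q1)// (bigD1 w)//= lerDl sumr_ge0// => i _.
    exact: ltW.
  by rewrite ln_ge0// ler_pdivlMr// mul1r ler_nat.
have -> : ln 9 = \sum_w P w * ln 9 :> R by rewrite -mulr_suml P1 mul1r.
rewrite /partition_entropy addrC -sumrB.
apply: ler_sum => w _; rewrite -[fine _]/(P w) -/(P w) -mulrBr.
have [P0|P0] := leP (P w) 0.
  have -> : P w = 0 by apply/eqP; rewrite eq_le P0 prob_ge0.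
  by rewrite !mul0r.
rewrite ler_wpM2l ?(ltW P0)//.
have : ln (P w / 2) <= ln (quant v w).
  by rewrite ler_ln ?posrE ?divr_gt0//; exact: Pq.
have -> : ln (P w / 2) = ln (P w) - ln 2 by rewrite ln_div ?posrE.
have -> : ln (9 / 2) = ln 9 - ln 2 :> R by rewrite ln_div ?posrE.
lra.
Qed.

End Quantization.

Lemma expn_pred2K a k : (2 <= a)%N -> (0 < k)%N ->
  (a ^ k).-2.+2 = (a ^ k)%N.
Proof.
move=> a2 k0; have : (2 <= a ^ k)%N.
  by rewrite (leq_trans a2)// -{1}(expn1 a) leq_exp2l.
by case: (a ^ k)%N => [|[|]].
Qed.

(** Blocks are taken so long that [ln 9] is negligible against their length.
    The integral of the cost for the limit measure is then below
    [k * (t + e)], and so are its averages over infinitely many squares of the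
    orbit. *)
Lemma small_entropy_low_cost (R : realType) (a b : nat) (t e : R) x :
  (2 <= a)%N -> 0 < e -> small_entropy_set a b t x ->
  exists k (v : {ffun 'I_(a ^ k).-2.+2 -> 'I_(a ^ k).-2.+3}),
    [/\ (0 < k)%N, \sum_w quant v w <= 1 :> R &
      forall N0, exists2 N, (N0 <= N)%N &
        low_cost a b k (cost (quant v)) (t + e) N x].
Proof.
case: a => [|[|a]]// _ e0 [mu [[muTa _] [N_ [Noo muN]] ht]].
have e20 : 0 < e / 2 by rewrite divr_gt0.
have [k [k0 Hk lnk]] : exists k, [/\ (0 < k)%N,
    forall n, n.+2 = (a.+2 ^ k)%N ->
      partition_entropy mu (@digit R n) < k%:R * (t + e / 2) &
    ln 9 < k%:R * (e / 2)].
  have Hk := small_entropy_digit muTa ht e20.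
  near (\oo : set_system nat) => k; exists k; split.
  - by near: k; exact: nbhs_infty_gt.
  - by near: k.
  - by rewrite -ltr_pdivrMr//; near: k; exact: nbhs_infty_gtr.
set n := (a.+2 ^ k).-2.
have nk : n.+2 = (a.+2 ^ k)%N.
  exact: expn_pred2K.
pose P w := prob mu (@digit R n @^-1` [set w]).
have P1 : \sum_w P w = 1.
  rewrite -(prob_setT mu) (prob_split mu (@measurable_digit R n) measurableT).
  by apply: eq_bigr => w _; rewrite setTI.
have [v v1 Pv] := quantize (fun w => prob_ge0 mu _) P1.
exists k, v; split=> // N0.
have q0 := @quant_gt0 R _ v.
have cc := continuous_cost q0.
have c0 := cost_ge0 q0 v1.
have lt : (\int[mu]_z cost (quant v) z)%R < k%:R * (t + e).
  apply: (le_lt_trans (integral_cost v1 Pv)).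
  by have := Hk _ nk; lra.
have /cvgrPdist_lt := weak_cvg_integral cc muN.
have d0 : 0 < k%:R * (t + e) - (\int[mu]_z cost (quant v) z)%R.
  by rewrite subr_gt0.
move=> /(_ _ d0) near_lt.
near (\oo : set_system nat) => j.
exists (N_ j).+1.
  apply: leqW; near: j; apply: (Noo [set m | (N0 <= m)%N]).
  exact: nbhs_infty_ge.
have h : `|(\int[mu]_z cost (quant v) z)%R -
    (\int[empirical_prob a.+2 b x (N_ j)]_z cost (quant v) z)%R| <
   k%:R * (t + e) - (\int[mu]_z cost (quant v) z)%R by near: j.
rewrite /low_cost /= -ler_pdivrMl ?exprn_gt0// -integral_empirical//.
by move: h; rewrite ltr_norml => /andP[h _]; lra.
Unshelve. all: by end_near. Qed.

(** The choice [th = sqrt (t / ln b)] makes the contributions [th * ln b] of the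
    rows and [t / th] of the words to the exponential growth of the number of
    arcs equal. *)
Lemma hausdorff_null_small_entropy (R : realType) (a b : nat) (t s : R) :
  (2 <= a)%N -> (2 <= b)%N -> 0 < t -> t < ln b%:R ->
  0 <= s <= 1 ->
  2 * Num.sqrt (ln b%:R) * Num.sqrt t <
    s * (ln a%:R + Num.sqrt (ln b%:R) * Num.sqrt t) ->
  hausdorff_measure s (small_entropy_set a b t : set (circle R)) = 0%E.
Proof.
move=> a2 b2 t0 tb s01 hs.
have B0 : 0 < ln b%:R :> R by exact: lt_trans tb.
set A := ln a%:R in hs; set B := ln b%:R in tb hs B0.
have sB0 : 0 < Num.sqrt B by rewrite sqrtr_gt0.
have st0 : 0 < Num.sqrt t by rewrite sqrtr_gt0.
pose th := Num.sqrt t / Num.sqrt B.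
have th01 : 0 < th < 1.
  by rewrite divr_gt0//= ltr_pdivrMr// mul1r ltr_sqrt.
have /andP[th0 _] := th01.
pose be := Num.sqrt B * Num.sqrt t.
have thB : th * B = be.
  by rewrite -[X in _ * X](sqr_sqrtr (ltW B0)) /th /be; field; rewrite gt_eqF.
have tth : t / th = be.
  rewrite -[X in X / _](sqr_sqrtr (ltW t0)) /th /be; field.
  by rewrite !gt_eqF.
pose kap := (s * (A + be) - 2 * be) / 2.
have kap0 : 0 < kap by rewrite divr_gt0// subr_gt0 mulrA.
pose e := th * kap.
have e0 : 0 < e by rewrite mulr_gt0.
have rate : (1 - s) * th * B + (t + e) / th - s * A <= - kap.
  have -> : (t + e) / th = be + kap.
    by rewrite mulrDl tth /e mulrAC divff ?gt_eqF// mul1r.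
  by rewrite -mulrA thB /kap; lra.
pose I : countType := {k : nat & {ffun 'I_(a ^ k).-2.+2 -> 'I_(a ^ k).-2.+3}}.
pose K (i : I) : set (circle R) := [set x |
  [/\ (0 < tag i)%N, \sum_w quant (tagged i) w <= 1 :> R & forall N0,
    exists2 N, (N0 <= N)%N &
      low_cost a b (tag i) (cost (quant (tagged i))) (t + e) N x]].
apply: (@hausdorff_null_sub _ _ _ _ (\bigcup_i K i)).
  move=> x /(small_entropy_low_cost a2 e0)[k [v [k0 v1 xN]]].
  by exists (Tagged (fun k => {ffun 'I_(a ^ k).-2.+2 -> 'I_(a ^ k).-2.+3}) v).
apply: hausdorff_null_bigcup => -[k v].
have [[k0 v1]|no] := pselect ((0 < k)%N /\ \sum_w quant v w <= 1 :> R);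
    last first.
  apply: hausdorff_null_sub (hausdorff_null0 s) => x [/= k0 v1 _].
  by apply: no.
have q0 := @quant_gt0 R _ v.
have nk := expn_pred2K a2 k0.
apply: hausdorff_null_sub (hausdorff_null_low_cost a2 (ltnW b2) k0 nk
  (blur_gt0 q0) _ (cost_ge0 q0 v1) (cost_ge q0) s01 th01 _ rate kap0).
- by move=> x [].
- by rewrite sum_blur.
- by rewrite addr_ge0 ?ltW.
Qed.

Theorem theorem1p6 (R : realType) (a b : nat) (t : R) :
  (2 <= a)%N -> (2 <= b)%N ->
  0 < t < Num.min (ln b%:R) (ln a%:R ^+ 2 / ln b%:R) ->
  (hausdorff_dim (small_entropy_set a b t : set (circle R)) <=
    (2 * Num.sqrt (ln b%:R) * Num.sqrt t /
      (ln a%:R + Num.sqrt (ln b%:R) * Num.sqrt t))%:E)%E.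
Proof.
move=> a2 b2 /andP[t0]; rewrite lt_min => /andP[tb ta].
have B0 : 0 < ln b%:R :> R by exact: lt_trans tb.
have A0 : 0 < ln a%:R :> R by rewrite ln_gt0// ltr1n.
set A := ln a%:R in A0 ta *; set B := ln b%:R in tb ta B0 *.
set beta := Num.sqrt B * Num.sqrt t.
have be0 : 0 < beta by rewrite mulr_gt0// sqrtr_gt0.
(* this puts the critical exponent below 1, leaving room for some [s <= 1] *)
have beA : beta < A.
  rewrite ltr_pdivlMr// mulrC in ta.
  rewrite /beta -sqrtrM ?(ltW B0)// -[A]gtr0_norm// -sqrtr_sqr.
  by rewrite ltr_sqrt// exprn_gt0.
have D0 : 0 < A + beta by rewrite addr_gt0.
rewrite -[2 * _ * _]mulrA -/beta; set s0 := 2 * beta / (A + beta).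
have s00 : 0 <= s0 by rewrite divr_ge0 ?mulr_ge0 ?(ltW be0) ?(ltW D0).
have s01 : s0 < 1 by rewrite ltr_pdivrMr// mul1r; lra.
apply/lee_addgt0Pr => e e0; rewrite -EFinD.
pose s := Num.min (s0 + e) 1.
apply: (@le_trans _ _ s%:E); last by rewrite lee_fin ge_min lexx.
have s0s : s0 < s by rewrite lt_min s01 ltrDl e0.
have s1 : 0 <= s <= 1.
  by rewrite (le_trans s00 (ltW s0s)) ge_min lexx orbT.
apply: ereal_inf_lbound; exists s => //; split; first by case/andP: s1.
apply: hausdorff_null_small_entropy => //.
by rewrite -/A -/B -mulrA -/beta -ltr_pdivrMr.
Qed.
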